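(* Let $(K,v)$ be a valued field of characteristic $0$ whose residue field has characteristic $p>0$, regarded as an $\mathcal{L}_{Mac}$-structure in the natural way. Suppose $\mathrm{Th}(K)$ admits quantifier elimination in $\mathcal{L}_{Mac}$, $(K,v)$ is of prohenselian degree $1$, $(K,v)$ is tight, and there is a conservative subgroup $\mathcal{C}$ of $K^\times$. Then there is a valued field $(L,w)$ such that $w$ is of rank $1$ and $(L,w)\equiv(K,v)$ as $\mathcal{L}_{Mac}$-structures.
   Context: Valuation rings are proper subrings. $\mathcal{L}_{Mac}=\{+,-,\cdot,0,1\}\cup\{\mathcal{O}\}\cup\{P_n:n>1\}$ with $\mathcal{O}$ interpreted as the valuation ring and $P_n$ as the set of nonzero $n$th powers. A valuation is of rank $1$ if its value group is nontrivial and its only convex subgroups are $\{0\}$ and itself. For $(L,w)$ with valuation ring $\mathcal{O}$, maximal ideal $\mathcal{M}$, and $r,t\in\mathcal{O}$: $r\asymp t$ if there is a natural number $n\ge1$ with $w(r^n)\le w(t)\le w(r^{n+1})$ or $w(t^n)\le w(r)\le w(t^{n+1})$; $r\ll t$ (also $t\gg r$) if they are not comparable and $w(r)<w(t)$. For $A\subseteq L$, $t\in A$ is a cofinal element of $A$ if $\{nw(t):n\in\mathbb{N}\}$ is cofinal in $\{w(r):r\in A\}$. $\mathbb{Q}(A)$ is the subfield generated by $A$; $F^L$ is the algebraic closure in $L$ of a subfield $F$. A valuation ring $R$ of a field $F$ admits a henselian coarsening if some henselian valuation ring $R'\subsetneq F$ contains $R$. $(L,w)$ is of prohenselian degree $1$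 if for every $t\in\mathcal{M}$ the valuation ring $\mathbb{Q}(t)^L\cap\mathcal{O}$ of $\mathbb{Q}(t)^L$ admits a henselian coarsening. $(K,v)$ is tight if $v(p)$ lies in the smallest nonzero convex subgroup of $vK$. A subgroup $\mathcal{C}$ of $K^\times$ with $\mathbb{Q}^\times\subseteq\mathcal{C}$ is conservative if (1) $p$ is a cofinal element of $\mathbb{Q}(r)^K$ for every $r\in\mathcal{C}$, and (2) $\mathcal{C}$ is an existentially closed substructure of $K^\times$ over $\mathbb{Q}^\times$ in the language of groups. *)

(* Defs.v *)
From HB Require Import structures.
From mathcomp Require Import all_boot all_order all_algebra.
From mathcomp Require Import generic_quotient ring_quotient.
From mathcomp Require Import boolp classical_sets.

Set Implicit Arguments.
Unset Strict Implicit.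
Unset Printing Implicit Defensive.

Import Order.TTheory GRing.Theory Num.Theory.
Local Open Scope classical_set_scope.
Local Open Scope ring_scope.
Local Open Scope quotient_scope.

(** * First-order logic *)

Record language := Language {
  func : Type;
  farity : func -> nat;
  rsym : Type;
  rarity : rsym -> nat
}.

Record structure (L : language) := Structure {
  carrier :> Type;
  fint : forall f : func L, ('I_(farity f) -> carrier) -> carrier;
  rint : forall r : rsym L, ('I_(rarity r) -> carrier) -> Prop
}.

(* Well-scoped de Bruijn syntax: the free variables of a [term L n] or a
   [formula L n] are indexed by 'I_n, and a quantifier binds index 0. *)
Inductive term (L : language) (n : nat) : Type :=
| Var of 'I_n
| App (f : func L) of ('I_(farity f) -> term L n).

Inductive formula (L : language) (n : nat) : Type :=
| Eq of term L n & term L n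
| Rel (r : rsym L) of ('I_(rarity r) -> term L n)
| Not of formula L n
| And of formula L n & formula L n
| Or of formula L n & formula L n
| Ex of formula L n.+1
| All of formula L n.+1.

Definition sentence (L : language) := formula L 0.

Fixpoint quantifier_free L n (phi : formula L n) : bool :=
  match phi with
  | Eq _ _ | Rel _ _ => true
  | Not a => quantifier_free a
  | And a b | Or a b => quantifier_free a && quantifier_free b
  | Ex _ | All _ => false
  end.

(* A block of existential quantifiers followed by a quantifier-free formula. *)
Fixpoint existential L n (phi : formula L n) : bool :=
  match phi with
  | Ex a => existential a
  | _ => quantifier_free phi
  end.

Section Semantics.
Variables (L : language) (M : structure L).

Definition env_cons n (x : M) (e : 'I_n -> M) (i : 'I_n.+1) : M :=
  if unlift ord0 i is Some j then e j else x.

Definition env_nil (i : 'I_0) : M :=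
  let: Ordinal _ lt_i_0 := i in False_rect _ (notF lt_i_0).

Fixpoint eval n (e : 'I_n -> M) (t : term L n) : M :=
  match t with
  | Var i => e i
  | App f a => fint (fun i => eval e (a i))
  end.

Fixpoint sat n (phi : formula L n) (e : 'I_n -> M) : Prop :=
  match phi with
  | Eq s t => eval e s = eval e t
  | Rel r a => rint (fun i => eval e (a i))
  | Not a => ~ sat a e
  | And a b => sat a e /\ sat b e
  | Or a b => sat a e \/ sat b e
  | Ex a => exists x, sat a (env_cons x e)
  | All a => forall x, sat a (env_cons x e)
  end.

Definition Th : set (sentence L) := [set s | sat s env_nil].

Definition models (T : set (sentence L)) : Prop := T `<=` Th.

End Semantics.

Definition elem_equiv (L : language) (M N : structure L) : Prop :=
  forall s : sentence L, Th M s <-> Th N s.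

Definition admits_QE (L : language) (T : set (sentence L)) : Prop :=
  forall n (phi : formula L n), exists psi : formula L n,
    quantifier_free psi /\
    forall M : structure L, models M T ->
      forall e : 'I_n -> M, sat phi e <-> sat psi e.

(* For an embedding [i] of [A] into [B] and a set [P] of parameters in [A]. *)
Definition existentially_closed_over (L : language) (A B : structure L)
    (i : A -> B) (P : set A) : Prop :=
  forall n (phi : formula L n), existential phi ->
    forall a : 'I_n -> A, (forall j, P (a j)) ->
      sat phi (i \o a) -> sat phi a.

(** * Valuations *)

Record oagroup := OAGroup {
  oag_sort :> porderZmodType;
  oag_total : total (<=%R : rel oag_sort);
  oag_leD : forall a b c : oag_sort, a <= b -> a + c <= b + c
}.

(* [option G] is G with an added greatest element [None], the value of 0. *)
Definition vle (G : oagroup) (a b : option G) : bool :=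
  match a, b with
  | _, None => true
  | None, Some _ => false
  | Some g, Some h => g <= h
  end.

Definition vadd (G : oagroup) (a b : option G) : option G :=
  if a is Some g then if b is Some h then Some (g + h) else None else None.

Definition vmuln (G : oagroup) (n : nat) (a : option G) : option G :=
  omap (fun g : G => g *+ n) a.

Record valuation (K : fieldType) := Valuation {
  value_group : oagroup;
  vfun :> K -> option value_group;
  vfun_None : forall x, vfun x = None <-> x = 0;
  vfunM : forall x y, vfun (x * y) = vadd (vfun x) (vfun y);
  vfunD : forall x y,
    vle (vfun x) (vfun (x + y)) || vle (vfun y) (vfun (x + y));
  vfun_surj : forall g : value_group, exists x, vfun x = Some g;
  (* valuation rings are proper subrings *)
  vfun_proper : exists x, ~~ vle (Some 0) (vfun x)
}.

Section ResidueField.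
Variables (K : fieldType) (v : valuation K).

Definition valring : pred K := fun x => vle (Some 0) (v x).
Definition valmax : pred K := fun x => valring x && (v x != Some 0).

Lemma vfun0 : v 0 = None. Proof. exact/vfun_None. Qed.

Lemma vfun1 : v 1 = Some 0.
Proof.
case E: (v 1) => [g|]; last by move/vfun_None/eqP: E; rewrite oner_eq0.
have := vfunM v 1 1; rewrite mulr1 E /= => -[] /eqP.
by rewrite -subr_eq0 opprD addrA subrr sub0r oppr_eq0 => /eqP ->.
Qed.

Lemma vfunN1 : v (- 1) = Some 0.
Proof.
have := vfunM v (- 1) (- 1); rewrite mulrNN mulr1 vfun1.
case: (v (- 1)) => [g|] //= [E].
have gN : - g = g by apply/eqP; rewrite eq_sym -addr_eq0 -E.
have [h|h] := orP (oag_total g 0); have := oag_leD (- g) h;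
  rewrite subrr sub0r gN => h'; congr Some; apply/le_anti; rewrite h h' //.
Qed.

Lemma vfunN x : v (- x) = v x.
Proof.
by rewrite -mulN1r vfunM vfunN1; case: (v x) => //= g; rewrite add0r.
Qed.

Lemma vle_trans (a b c : option (value_group v)) :
  vle a b -> vle b c -> vle a c.
Proof. by case: a b c => [a|] [b|] [c|] //=; apply: le_trans. Qed.

Fact valring_subring : subring_closed valring.
Proof.
rewrite /valring; split; first by rewrite unfold_in vfun1 /=.
- move=> x y; rewrite !unfold_in => Hx Hy.
  by case/orP: (vfunD v x (- y)); rewrite ?vfunN; apply: vle_trans.
move=> x y; rewrite !unfold_in vfunM.
case: (v x) (v y) => [g|] [h|] //= g0 h0.
by apply: le_trans h0 _; rewrite -[h in h <= _]add0r; apply: oag_leD.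
Qed.
HB.instance Definition _ :=
  GRing.isSubringClosed.Build K valring valring_subring.

Definition valring_type := {x : K | valring x}.
HB.instance Definition _ := SubChoice.on valring_type.
HB.instance Definition _ := [SubChoice_isSubComNzRing of valring_type by <:].

Definition residue_ideal : pred valring_type := fun x => valmax (val x).

Fact residue_idealP : idealr_closed residue_ideal.
Proof.
have leP (x : K) : valmax x = vle (Some 0) (v x) && ~~ vle (v x) (Some 0).
  rewrite /valmax /valring; case: (v x) => [g|] //=.
  case g0: (0 <= g) => //=; rewrite -[Some g == Some 0]/(g == 0).
  by rewrite eq_le g0 andbT.
rewrite /residue_ideal; split.
- by rewrite unfold_in leP vfun0.
- by rewrite unfold_in leP vfun1 /= lexx.
move=> [a a0] [x x0] [y y0].
rewrite !unfold_in /= !leP => /andP[_ xp] /andP[_ yp].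
have axp : vle (v x) (v (a * x)).
  rewrite vfunM; move: a0; rewrite /valring.
  case: (v a) (v x) => [g|] [h|] //= g0.
  by rewrite -[h in h <= _]add0r; apply: oag_leD.
have key : ~~ vle (v (a * x + y)) (Some 0).
  case/orP: (vfunD v (a * x) y) => h; apply/negP => h'.
    by case/negP: xp; apply: vle_trans axp _; apply: vle_trans h h'.
  by case/negP: yp; apply: vle_trans h h'.
rewrite key andbT; case/orP: (vfunD v (a * x) y); apply: vle_trans => //.
exact: vle_trans x0 axp.
Qed.
HB.instance Definition _ :=
  isIdealr.Build valring_type residue_ideal residue_idealP.

(* O/M, as a commutative ring. *)
Definition residue_ring : comNzRingType :=
  {ideal_quot (residue_ideal : idealr valring_type)}.

Lemma pchar_residue_ring p :
  (p \in [pchar residue_ring]) = prime p && valmax p%:R.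
Proof.
pose I : idealr valring_type := residue_ideal.
rewrite inE; congr andb.
have -> : (p%:R : residue_ring) = \pi_{ideal_quot I} p%:R by rewrite rmorph_nat.
have -> : (0 : residue_ring) = \pi_{ideal_quot I} 0 by rewrite rmorph0.
rewrite -Quotient.idealrBE subr0 unfold_in /residue_ideal.
by rewrite (rmorph_nat (GRing.RMorphism.clone _ _ (val : valring_type -> K) _)).
Qed.

End ResidueField.

Definition convex_subgroup (G : oagroup) (H : set G) : Prop :=
  [/\ H 0, (forall a b, H a -> H b -> H (a - b)) &
      forall a b, H b -> 0 <= a -> a <= b -> H a].

Definition rank1 (K : fieldType) (v : valuation K) : Prop :=
  (exists g : value_group v, g <> 0) /\
  forall H : set (value_group v), convex_subgroup H -> H = [set 0] \/ H = setT.

Definition tight (K : fieldType) (v : valuation K) (p : nat) : Prop :=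
  exists H : set (value_group v),
    [/\ convex_subgroup H, H <> [set 0],
        forall H', convex_subgroup H' -> H' <> [set 0] -> H `<=` H' &
        exists2 g, v p%:R = Some g & H g].

(* 0 is discarded from [A], since its value is infinite. *)
Definition cofinal_element (K : fieldType) (v : valuation K) (A : set K) (t : K)
  : Prop :=
  A t /\ forall r, A r -> r != 0 -> exists n, vle (v r) (vmuln n (v t)).

(** * Subfields and henselianity *)

Section Subfields.
Variable K : fieldType.
Implicit Types F R A : set K.

Definition subring R : Prop :=
  [/\ R 1, (forall x y, R x -> R y -> R (x - y)) &
      forall x y, R x -> R y -> R (x * y)].

Definition subfield F : Prop := subring F /\ forall x, F x -> F x^-1.

Definition gen_subfield A : set K :=
  [set x | forall F, subfield F -> A `<=` F -> F x].

Definition coefs_in R (f : {poly K}) : Prop := forall i, R f`_i.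

Definition relative_alg_closure F : set K :=
  [set x | exists f : {poly K}, [/\ f != 0, coefs_in F f & root f x]].

(* [R] is a valuation ring of the subfield [F]; [`<`] is strict inclusion. *)
Definition valuation_ring F R : Prop :=
  [/\ subring R, R `<` F & forall x, F x -> x != 0 -> R x \/ R x^-1].

Definition maximal_ideal R : set K :=
  [set x | R x /\ ~ (x != 0 /\ R x^-1)].

Definition henselian R : Prop :=
  forall (f : {poly K}) a, coefs_in R f -> R a ->
    maximal_ideal R f.[a] -> ~ maximal_ideal R f^`().[a] ->
    exists b, [/\ R b, f.[b] = 0 & maximal_ideal R (b - a)].

Definition admits_henselian_coarsening F R : Prop :=
  exists R', [/\ valuation_ring F R', henselian R' & R `<=` R'].

End Subfields.

Definition prohenselian_degree1 (K : fieldType) (v : valuation K) : Prop :=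
  forall t : K, valmax v t ->
    let F := relative_alg_closure (gen_subfield [set t]) in
    admits_henselian_coarsening F (F `&` [set x | valring v x]).

(** * The Macintyre language *)

Variant mac_func := MAdd | MOpp | MMul | MZero | MOne.

Definition mac_farity (f : mac_func) : nat :=
  match f with MAdd | MMul => 2 | MOpp => 1 | MZero | MOne => 0 end.

Variant mac_rel := MO | MP n of (1 < n)%N.

Definition L_Mac := Language mac_farity (fun _ : mac_rel => 1%N).

Section MacStructure.
Variables (K : fieldType) (v : valuation K).

Definition mac_fint (f : mac_func) : ('I_(mac_farity f) -> K) -> K :=
  match f with
  | MAdd => fun a => a ord0 + a ord_max
  | MOpp => fun a => - a ord0
  | MMul => fun a => a ord0 * a ord_max
  | MZero => fun _ => 0
  | MOne => fun _ => 1
  end.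

Definition mac_rint (r : mac_rel) (a : 'I_1 -> K) : Prop :=
  match r with
  | MO => valring v (a ord0)
  | MP n _ => a ord0 != 0 /\ exists y, a ord0 = y ^+ n
  end.

Definition mac_structure : structure L_Mac :=
  @Structure L_Mac K mac_fint mac_rint.

End MacStructure.

(** * Multiplicative subgroups *)

Variant grp_func := GMul | GInv | GOne.

Definition grp_farity (f : grp_func) : nat :=
  match f with GMul => 2 | GInv => 1 | GOne => 0 end.

Definition L_grp := @Language grp_func grp_farity void (fun _ => 0%N).

Section MulSubgroups.
Variable K : fieldType.

(* Subgroups of the multiplicative group of nonzero elements. *)
Record mul_subgroup := MulSubgroup {
  mul_mem : set K;
  mul_mem_neq0 : forall x, mul_mem x -> x != 0;
  mul_mem1 : mul_mem 1;
  mul_memM : forall x y, mul_mem x -> mul_mem y -> mul_mem (x * y);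
  mul_memV : forall x, mul_mem x -> mul_mem x^-1
}.

Definition grp_fint (C : mul_subgroup) (f : grp_func) :
  ('I_(grp_farity f) -> {x | mul_mem C x}) -> {x | mul_mem C x} :=
  match f with
  | GMul => fun a => exist _ _ (mul_memM (svalP (a ord0)) (svalP (a ord_max)))
  | GInv => fun a => exist _ _ (mul_memV (svalP (a ord0)))
  | GOne => fun _ => exist _ _ (mul_mem1 C)
  end.

Definition grp_structure (C : mul_subgroup) : structure L_grp :=
  @Structure L_grp {x | mul_mem C x} (@grp_fint C) (fun r => match r with end).

Definition full_mul_group : mul_subgroup :=
  @MulSubgroup [set x | x != 0] (fun x x0 => x0) (oner_neq0 K)
    (fun x y x0 y0 => mulf_neq0 x0 y0) (fun x x0 => invr_neq0 x0).

Definition mul_incl (C : mul_subgroup) (x : grp_structure C) :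
  grp_structure full_mul_group := exist _ (sval x) (mul_mem_neq0 (svalP x)).

Definition rational_units : set K :=
  [set x | exists2 q : rat, q != 0 & x = ratr q].

Definition conservative (v : valuation K) (p : nat) (C : mul_subgroup) : Prop :=
  [/\ rational_units `<=` mul_mem C,
      (forall r, mul_mem C r ->
         cofinal_element v (relative_alg_closure (gen_subfield [set r])) p%:R) &
      existentially_closed_over (@mul_incl C)
        [set x | rational_units (sval x)]].

End MulSubgroups.

(* Main.v *)
Require Import Defs.
From mathcomp Require Import all_boot all_order all_algebra.
From HB Require Import structures.
From mathcomp Require Import generic_quotient boolp classical_sets ring.

(** The model of rank 1 comes from the omitting types theorem. Since [Th(K)] is
complete, a countable model has rank 1 as soon as it omits the types
"[v(x) > n v(p)] for all [n]" and "[0 < n v(x) < v(p)] for all [n]", and both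
can be omitted if neither is isolated. The second one is not realized in [K],
because [K] is tight. For the first one, suppose that an infinitesimal [x]
satisfies [psi], and let [theta(z)] say that some nonzero [y] with
[v(y) <= v(z)] satisfies [psi]. By quantifier elimination [theta] is
equivalent to a quantifier-free formula, and such a formula without parameters
cannot distinguish [x^M] from [p^M] when [M] is divisible enough: for
[f = X^k (a + X g)] over the integers, [f(x^M)] and [f(p^M)] are both [a] times
an [n]-th power, by Hensel's lemma in a coarsening of [Q(x)^K] or [Q(p)^K].
As [theta(x^M)] holds, so does [theta(p^M)], which gives an element of finite
value satisfying [psi]. *)

Set Implicit Arguments.
Unset Strict Implicit.
Unset Printing Implicit Defensive.

Import Order.TTheory GRing.Theory.
Local Open Scope classical_set_scope.
Local Open Scope ring_scope.

(** * Definable sets *)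

Section Renaming.
Variable L : language.

(** The formula [psi] itself may tell [x] from [p], and although high powers of the two look alike,
    [psi] need not hold at them. The set defined by [theta] is closed under increasing the value, so
    it contains every positive power of [x], and the exponent can be chosen after the
    quantifier-free formula is known. The obstacle to Hensel's lemma is that only a coarsening of
    unknown size is henselian, and an element of the maximal ideal of the given ring can become a
    unit there. It is therefore applied only to multiples of [x]: the powers of [x] are cofinal in
    the values of [Q(x)^K], so [x^-1] lies outside every proper coarsening. The model is built
    without syntactic consistency. As [Th(K)] is complete, a consistent formula is the same as a
    nonempty definable set in [K]; the forcing conditions are nonempty definable sets of assignments
    [nat -> K], the coordinates act as Henkin constants, and the model is their quotient by a
    generic filter. *)

Fixpoint term_rename m n (r : 'I_m -> 'I_n) (t : term L m) : term L n :=
  match t with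
  | Var i => Var L (r i)
  | App f a => App (fun i => term_rename r (a i))
  end.

Definition up_rename m n (r : 'I_m -> 'I_n) (i : 'I_m.+1) : 'I_n.+1 :=
  if unlift ord0 i is Some j then lift ord0 (r j) else ord0.

Fixpoint rename m n (r : 'I_m -> 'I_n) (phi : formula L m) : formula L n :=
  match phi with
  | Eq s t => Eq (term_rename r s) (term_rename r t)
  | Rel R a => Rel (fun i => term_rename r (a i))
  | Not a => Not (rename r a)
  | And a b => And (rename r a) (rename r b)
  | Or a b => Or (rename r a) (rename r b)
  | Ex a => Ex (rename (up_rename r) a)
  | All a => All (rename (up_rename r) a)
  end.

Variable M : structure L.

Lemma env_cons0 n (x : M) (e : 'I_n -> M) : env_cons x e ord0 = x.
Proof. by rewrite /env_cons unlift_none. Qed.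

Lemma env_consS n (x : M) (e : 'I_n -> M) j : env_cons x e (lift ord0 j) = e j.
Proof. by rewrite /env_cons liftK. Qed.

Lemma env_cons_eta n (e : 'I_n.+1 -> M) :
  env_cons (e ord0) (fun i => e (lift ord0 i)) = e.
Proof.
apply: funext => i; case: (unliftP ord0 i) => [j|] ->.
  by rewrite env_consS.
by rewrite env_cons0.
Qed.

Lemma env_cons_up m n (r : 'I_m -> 'I_n) (x : M) (e : 'I_n -> M) :
  env_cons x e \o up_rename r = env_cons x (e \o r).
Proof.
apply: funext => i; rewrite /= /up_rename.
case: (unliftP ord0 i) => [j|] ->; first by rewrite !env_consS.
by rewrite !env_cons0.
Qed.

Lemma eval_rename m n (r : 'I_m -> 'I_n) (t : term L m) (e : 'I_n -> M) :
  eval e (term_rename r t) = eval (e \o r) t.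
Proof. by elim: t => //= f a IH; congr fint; apply: funext. Qed.

Lemma sat_rename m n (r : 'I_m -> 'I_n) (phi : formula L m) (e : 'I_n -> M) :
  sat (rename r phi) e = sat phi (e \o r).
Proof.
elim: phi n r e => {m} /=.
- by move=> m s t n r e; rewrite !eval_rename.
- by move=> m R a n r e; congr rint; apply: funext => i; apply: eval_rename.
- by move=> m a IH n r e; rewrite IH.
- by move=> m a IHa b IHb n r e; rewrite IHa IHb.
- by move=> m a IHa b IHb n r e; rewrite IHa IHb.
- move=> m a IH n r e; apply: eq_exists => x.
  by rewrite IH env_cons_up.
- move=> m a IH n r e; apply: eq_forall => x.
  by rewrite IH env_cons_up.
Qed.

(** Since [k'.+1 + m] reduces to [(k' + m).+1], each [Ex] is added without a cast. *)
Fixpoint exists_first k m : formula L (k + m) -> formula L m :=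
  match k with
  | 0 => id
  | k'.+1 => fun phi => exists_first (Ex phi : formula L (k' + m))
  end.

Lemma sat_exists_first k m (phi : formula L (k + m)) (e : 'I_m -> M) :
  sat (exists_first phi) e <->
  exists E : 'I_(k + m) -> M, (forall j, E (rshift k j) = e j) /\ sat phi E.
Proof.
elim: k phi => [|k IH] phi.
  have r0 (j : 'I_m) : rshift 0 j = j by apply: val_inj.
  split=> [phie | [E [Ee phiE]]]; first by exists e; split=> // j; rewrite r0.
  by rewrite (_ : e = E) //; apply: funext => j; rewrite -Ee r0.
have rS (j : 'I_m) : rshift k.+1 j = lift ord0 (rshift k j) by apply: val_inj.
split.
  case/IH => E [Ee [x phix]]; exists (env_cons x E); split=> // j.
  by rewrite rS env_consS.
case=> E [Ee phiE]; apply/IH; exists (fun i => E (lift ord0 i)).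
by split=> [j|]; [rewrite -rS | exists (E ord0); rewrite env_cons_eta].
Qed.

(** All formulas are read in the single space [nat -> M], where [r] says which coordinates the
    variables name; formulas with different numbers of variables can then be intersected. *)
Definition defset k (phi : formula L k) (r : 'I_k -> nat) : set (nat -> M) :=
  [set e : nat -> M | sat phi (e \o r)].

Definition definable (D : set (nat -> M)) : Prop :=
  exists k (phi : formula L k) r, D = defset phi r.

Lemma definable_defset k (phi : formula L k) r : definable (defset phi r).
Proof. by exists k, phi, r. Qed.

Lemma definableI D1 D2 : definable D1 -> definable D2 -> definable (D1 `&` D2).
Proof.
move=> [k1 [phi1 [r1 ->]]] [k2 [phi2 [r2 ->]]].
exists (k1 + k2)%N, (And (rename (@lshift _ _) phi1) (rename (@rshift _ _) phi2)).
pose r i := match split i with inl j => r1 j | inr j => r2 j end; exists r.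
have E1 (e : nat -> M) : (e \o r) \o @lshift k1 k2 = e \o r1.
  by apply: funext => j; rewrite /r /= (unsplitK (inl j)).
have E2 (e : nat -> M) : (e \o r) \o @rshift k1 k2 = e \o r2.
  by apply: funext => j; rewrite /r /= (unsplitK (inr j)).
by apply/seteqP; split=> e; rewrite /defset /= !sat_rename E1 E2.
Qed.

Lemma definableC D : definable D -> definable (~` D).
Proof. by move=> [k [phi [r ->]]]; exists k, (Not phi), r. Qed.

(** A formula reads finitely many coordinates, so a fresh one is always available to store a
    witness. *)
Lemma definable_bound D : definable D ->
  exists N, forall e e' : nat -> M, (forall i, (i < N)%N -> e i = e' i) ->
    D e -> D e'.
Proof.
move=> [k [phi [r ->]]]; exists (\max_i (r i)).+1 => e e' ee'.
rewrite /defset /= (_ : e \o r = e' \o r) //; apply: funext => i /=.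
by apply: ee'; rewrite ltnS; apply: leq_bigmax.
Qed.

(** This turns a forcing condition into a formula in one variable without parameters, to which the
    non-isolation of a type applies. *)
Lemma definable_proj D n : definable D ->
  exists psi : formula L 1, forall y,
    sat psi (fun=> y) <-> exists2 e, D e & e n = y.
Proof.
move=> [k [phi [r ->]]].
pose N := maxn n (\max_i (r i)).
have rN i : (r i <= N)%N by rewrite leq_max leq_bigmax orbT.
(* The coordinates up to [N] become the bound variables, and the last variable is left free for [y].
   The default of [inord] is harmless, because only indices up to [N] occur. *)
pose c (i : nat) : 'I_(N.+1 + 1) := lshift 1 (inord i).
exists (exists_first (And (rename (c \o r) phi)
                       (Eq (Var L (c n)) (Var L (rshift N.+1 ord0))))) => y.
rewrite sat_exists_first; split.
  case=> E [Ey /= []]; rewrite sat_rename compA => phiE En.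
  by exists (E \o c) => //=; rewrite En Ey.
case=> e phie eny.
exists (fun i => match split i with inl j => e j | inr _ => y end); split=> [j|].
  by rewrite (unsplitK (inr j)).
have Ec i : (i <= N)%N ->
  match split (c i) with inl j => e j | inr _ => y end = e i.
  by move=> iN; rewrite (unsplitK (inl (inord i))) inordK.
rewrite /= sat_rename; split; last by rewrite Ec ?leq_maxl // (unsplitK (inr _)).
suff -> : (fun i => match split i with inl j => e j | inr _ => y end) \o (c \o r)
          = e \o r by [].
by apply: funext => i; rewrite /= Ec.
Qed.

End Renaming.

(** * Countability of the formulas of a countable language *)

Section Coding.
Variables (L : language) (cf : func L -> nat) (cr : rsym L -> nat).
Hypotheses (cf_inj : injective cf) (cr_inj : injective cr).

Local Notation tree := (GenTree.tree nat).

(** Arguments are functions on ordinals; listing their values gives finite trees labelled by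
    numbers, which form a countable type. *)
Fixpoint code_term n (t : term L n) : tree :=
  match t with
  | Var i => GenTree.Leaf (nat_of_ord i)
  | App f a => GenTree.Node (cf f) [seq code_term (a i) | i <- enum 'I_(farity f)]
  end.

(** Injectivity is required only at the values of [a], which is the shape of the induction
    hypothesis for the arguments of a symbol. *)
Lemma map_enum_inj (T : Type) (T' : Type) n (g : T -> T') (a b : 'I_n -> T) :
  (forall i y, g (a i) = g y -> a i = y) ->
  [seq g (a i) | i <- enum 'I_n] = [seq g (b i) | i <- enum 'I_n] -> a = b.
Proof.
move=> g_inj E; apply: funext => i; apply: g_inj.
have sz : (i < size (enum 'I_n))%N by rewrite size_enum_ord.
have := congr1 (fun s => nth (g (a i)) s i) E.
by rewrite !(nth_map i _ _ sz) (nth_ord_enum i i) => ->.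
Qed.

Lemma code_term_inj n : injective (@code_term n).
Proof.
elim=> [i|f a IH] [j|g b] //= [].
  by move/val_inj ->.
move/cf_inj => fg; case: g / fg b => b.
by move/(map_enum_inj IH) ->.
Qed.

Fixpoint code_formula n (phi : formula L n) : tree :=
  match phi with
  | Eq s t => GenTree.Node 0 [:: code_term s; code_term t]
  | Rel R a => GenTree.Node 1 (GenTree.Leaf (cr R)
                 :: [seq code_term (a i) | i <- enum 'I_(rarity R)])
  | Not a => GenTree.Node 2 [:: code_formula a]
  | And a b => GenTree.Node 3 [:: code_formula a; code_formula b]
  | Or a b => GenTree.Node 4 [:: code_formula a; code_formula b]
  | Ex a => GenTree.Node 5 [:: code_formula a]
  | All a => GenTree.Node 6 [:: code_formula a]
  end.

Lemma code_formula_inj n : injective (@code_formula n).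
Proof.
elim=> {n} [n s t|n R a|n a IH|n a IHa b IHb|n a IHa b IHb|n a IH|n a IH]
  [s' t'|R' a'|a'|a' b'|a' b'|a'|a'] //= [].
- by move=> /code_term_inj -> /code_term_inj ->.
- move/cr_inj => RR; case: R' / RR a' => a'.
  by move/(map_enum_inj (fun i => @code_term_inj _ (a i))) ->.
- by move/IH ->.
- by move=> /IHa -> /IHb ->.
- by move=> /IHa -> /IHb ->.
- by move/IH ->.
- by move/IH ->.
Qed.

Definition interpreted_formula := {k : nat & formula L k * ('I_k -> nat)}%type.

Definition code_interpreted (t : interpreted_formula) : nat :=
  let: existT k (phi, r) := t in
  pickle (k, code_formula phi, [seq r i | i <- enum 'I_k]).

Lemma code_interpreted_inj : injective code_interpreted.
Proof.
move=> [k [phi r]] [k' [phi' r']] /(pcan_inj pickleK) [kk].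
case: k' / kk phi' r' => phi' r' /code_formula_inj ->.
by move/(@map_enum_inj _ _ _ id r r' (fun _ _ => id)) ->.
Qed.

End Coding.

(** * Generic filters and omitting types *)

(* The Rasiowa-Sikorski lemma for a forcing notion of sets ordered by inclusion. *)
Lemma generic_filter_exists (X : Type) (cond : set X -> Prop)
    (req : nat -> set X -> Prop) (D0 : set X) :
  cond D0 -> (forall D, cond D -> D !=set0) ->
  (forall i D, cond D -> exists D', [/\ cond D', D' `<=` D & req i D']) ->
  exists F : set X -> Prop,
    [/\ F setT, (forall A B, F A -> F B -> F (A `&` B)),
        (forall A B : set X, A `<=` B -> F A -> F B), ~ F set0 &
        forall i, exists2 D, req i D & F D].
Proof.
move=> cD0 cond_n0 dense.
have /choice[next nextP] : forall iD : nat * set X, exists D', cond iD.2 ->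
    [/\ cond D', D' `<=` iD.2 & req iD.1 D'].
  move=> [i D]; have [cD|ncD] := pselect (cond D); last by exists D.
  by have [D' ?] := dense i D cD; exists D'.
pose chain := fix chain i := if i is j.+1 then next (j, chain j) else D0.
have cchain i : cond (chain i).
  by elim: i => //= i IH; have [] := nextP (i, chain i) IH.
have chainS i : chain i.+1 `<=` chain i.
  by have [] := nextP (i, chain i) (cchain i).
have chain_anti i j : (i <= j)%N -> chain j `<=` chain i.
  elim: j => [|j IH]; first by rewrite leqn0 => /eqP ->.
  rewrite leq_eqVlt => /predU1P[-> //|/IH ij].
  exact: subset_trans (chainS j) ij.
exists (fun A => exists i, chain i `<=` A); split.
- by exists 0%N.
- move=> A B [i iA] [j jB]; exists (maxn i j); rewrite subsetI.
  by split; [apply: subset_trans iA|apply: subset_trans jB];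
    apply: chain_anti; rewrite ?leq_maxl ?leq_maxr.
- by move=> A B AB [i iA]; exists i; apply: subset_trans AB.
- by case=> i i0; have [e /i0] := cond_n0 _ (cchain i).
- move=> i; exists (chain i.+1); last by exists i.+1.
  by have [] := nextP (i, chain i) (cchain i).
Qed.

Section GenericFilter.
Variables (L : language) (M : structure L).

(** An ultrafilter on the definable sets with Henkin witnesses. Witnesses have to be coordinates, so
    a type is omitted in the quotient once every coordinate omits it. *)
Record generic_filter (F : set (nat -> M) -> Prop) : Prop := GenericFilter {
  gen_setT : F setT;
  gen_setI : forall A B, F A -> F B -> F (A `&` B);
  gen_sub : forall A B : set (nat -> M), A `<=` B -> F A -> F B;
  gen_set0 : ~ F set0;
  gen_decide : forall k (phi : formula L k) r,
    F (defset phi r) \/ F (~` defset phi r);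
  gen_witness : forall k (phi : formula L k.+1) (r : 'I_k -> nat),
    F (defset (Ex phi) r) ->
    exists m, F [set e : nat -> M | sat phi (env_cons (e m) (e \o r))]
}.

Lemma witness_definable k (phi : formula L k.+1) (r : 'I_k -> nat) m :
  definable [set e : nat -> M | sat phi (env_cons (e m) (e \o r))].
Proof.
exists k.+1, phi, (fun i => if unlift ord0 i is Some j then r j else m).
apply/seteqP; split=> e; rewrite /defset /=; set f := (X in sat phi X);
  set f' := (X in _ -> sat phi X); suff -> : f = f' by [].
all: by apply: funext => i; rewrite /f /f' /env_cons /=; case: unlift.
Qed.

Variables (cf : func L -> nat) (cr : rsym L -> nat).
Hypotheses (cf_inj : injective cf) (cr_inj : injective cr).

(* The omitting types theorem, where [P n B] says that some formula of the [n]-th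
   type fails on all of [B]. *)
Lemma generic_filter_omitting (x0 : M) (P : nat -> set M -> Prop) :
  (forall n A, A !=set0 -> (exists psi : formula L 1,
      forall y, A y <-> sat psi (fun=> y)) ->
    exists B, [/\ P n B, A `&` B !=set0 & exists psi : formula L 1,
      forall y, B y <-> sat psi (fun=> y)]) ->
  exists F, generic_filter F /\
    forall n i, exists2 B, P n B & F [set e | B (e i)].
Proof.
move=> omit.
pose cond (D : set (nat -> M)) := D !=set0 /\ definable D.
(* Accepting a formula [Ex psi] includes naming the coordinate that witnesses it. *)
pose dec (t : interpreted_formula L) (D : set (nat -> M)) :=
  let: existT k (phi, r) := t in
  (D `<=` defset phi r /\ if phi is Ex psi then
      exists m, D `<=` [set e | sat psi (env_cons (e m) (e \o r))] else True)
  \/ D `<=` ~` defset phi r.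
pose req1 i D := forall t, code_interpreted cf cr t = i -> dec t D.
pose req2 i D := forall n j, i = pickle (n, j) ->
  exists2 B, P n B & D `<=` [set e : nat -> M | B (e j)].
have condI D A : cond D -> definable A -> D `&` A !=set0 -> cond (D `&` A).
  by move=> [_ dD] dA n0; split=> //; apply: definableI.
have dense1 i D : cond D -> exists D', [/\ cond D', D' `<=` D & req1 i D'].
  move=> cD; have [[t ti]|no] := pselect (exists t, code_interpreted cf cr t = i);
    last by exists D; split=> // t ti; case: no; exists t.
  suff [D' [? ? dD']] : exists D', [/\ cond D', D' `<=` D & dec t D'].
    exists D'; split=> // t'; rewrite -ti => /(code_interpreted_inj cf_inj cr_inj).
    by move->.
  case: t {ti} => k [phi r].
  have [n0|e0] := pselect (D `&` defset phi r !=set0); last first.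
    exists D; split=> //; right=> e De phie; apply: e0; by exists e.
  have cD1 := condI _ _ cD (definable_defset M phi r) n0.
  case: phi n0 cD1 => [s t|R a|a|a b|a b|psi|a] n0 cD1;
    try (by eexists; split; [exact: cD1|exact: subIsetl|left; split=> //; exact: subIsetr]).
  case: n0 => e [De [x psix]].
  have [N0 ND] := definable_bound cD.2.
  (* Coordinate [N] is read neither by [D] nor through [r], so the witness [x] can be stored there
     without leaving [D]. *)
  pose N := (maxn N0 (\max_i (r i)).+1)%N.
  pose e' j := if j == N then x else e j.
  have rN j : (r j < N)%N.
    by rewrite leq_max ltnS leq_bigmax orbT.
  exists (D `&` [set e | sat psi (env_cons (e N) (e \o r))]); split=> //.
    apply: condI => //; first exact: witness_definable.
    exists e'; split.
      apply: (ND e) => // j jN; rewrite /e' ltn_eqF //.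
      by apply: leq_trans jN _; apply: leq_maxl.
    rewrite /= /e' eqxx (_ : _ \o r = e \o r) //.
    by apply: funext => j /=; rewrite ltn_eqF.
  left; split=> [e1 [_ psie1]|]; first by exists (e1 N).
  by exists N => e1 [].
have dense2 i D : cond D -> exists D', [/\ cond D', D' `<=` D & req2 i D'].
  move=> cD; have [[[n j] E]|no] := pselect (exists nj, i = pickle (nj : nat * nat));
    last by exists D; split=> // n j E; case: no; exists (n, j).
  have [[e De] [psi psiP]] : D !=set0 /\ exists psi : formula L 1,
      forall y, [set y | exists2 e, D e & e j = y] y <-> sat psi (fun=> y).
    by have [psi psiP] := definable_proj j cD.2; split; [exact: cD.1|exists psi => y; rewrite psiP].
  (* [B] meets the projection of [D] to coordinate [j], so confining that coordinate to [B] leaves a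
     nonempty condition. *)
  have [B [PB [y [[e' De' <-] By]] [chi chiB]]] :=
    omit n [set y | exists2 e, D e & e j = y] (ex_intro _ (e j) (ex_intro2 _ _ e De erefl))
      (ex_intro _ psi psiP).
  exists (D `&` [set e | B (e j)]); split=> //.
    apply: condI => //; last by exists e'.
    exists 1%N, chi, (fun=> j); apply/seteqP.
    by split=> e1; rewrite /defset /= chiB.
  move=> n' j'; rewrite E => /(pcan_inj pickleK)[<- <-].
  by exists B => // e1 [].
have [|||F [FT FI Fsub F0 Freq]] := @generic_filter_exists _ cond
    (fun i D => req1 i D /\ req2 i D) setT.
- split; first by exists (fun=> x0).
  have [k0 [phi0 [r0 E]]] : definable (~` set0 : set (nat -> M)).
    apply: definableC; exists 1%N.
    exists (And (Eq (Var L ord0) (Var L ord0)) (Not (Eq (Var L ord0) (Var L ord0)))).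
    by exists (fun=> 0%N); apply/seteqP; split=> e //= -[].
  by exists k0, phi0, r0; rewrite -E setC0.
- by move=> D [].
- move=> i D /(dense1 i)[D1 [cD1 D1D r1]].
  have [D2 [cD2 D2D1 r2]] := dense2 i D1 cD1.
  exists D2; split=> //; first exact: subset_trans D1D.
  split=> // -[k [phi r]] ti; have /= := r1 _ ti.
  case=> [[Dphi wit]|Dphi]; [left|right; exact: subset_trans Dphi].
  split; first exact: subset_trans Dphi.
  by case: phi {ti Dphi} wit => // psi [m Dm]; exists m; apply: subset_trans Dm.
exists F; split; last first.
  move=> n i; have [D [_ r2] FD] := Freq (pickle (n, i)).
  by have [B PB DB] := r2 n i erefl; exists B => //; apply: Fsub FD.
split=> // [k phi r|k phi r Fex].
  have [D [/(_ _ erefl) dD _] FD] :=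
    Freq (code_interpreted cf cr (existT _ k (phi, r))).
  by case: dD => [[Dphi _]|Dphi]; [left|right]; apply: Fsub FD.
have [D [/(_ _ erefl) dD _] FD] :=
  Freq (code_interpreted cf cr (existT _ k (Ex phi, r))).
case: dD => [[_ [m Dm]]|Dphi]; first by exists m; apply: Fsub FD.
by case: F0; apply: Fsub (FI _ _ Fex FD) => e [? /Dphi].
Qed.
(** Some element equals [t] under every assignment, so the witness property supplies a coordinate;
    this closes the quotient under the function symbols. *)
Lemma generic_term F : generic_filter F -> forall k (t : term L k) r,
  exists m, F [set e | e m = eval (e \o r) t].
Proof.
move=> gF k t r.
have [|m] := gen_witness gF
    (phi := Eq (Var L ord0) (term_rename (lift ord0) t)) (r := r).
  apply: gen_sub gF _ _ _ (gen_setT gF) => e _.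
  exists (eval (e \o r) t); rewrite /= eval_rename env_cons0; congr eval.
  by apply: funext => i; rewrite /= env_consS.
move=> Fm; exists m; apply: gen_sub gF _ _ _ Fm => e /=.
rewrite eval_rename env_cons0 => ->; congr eval.
by apply: funext => i; rewrite /= env_consS.
Qed.

End GenericFilter.

(** * Valuations *)

Section ValueGroup.
Variables (K : fieldType) (O : pred K).
Hypotheses (O1 : O 1) (OB : forall x y, O x -> O y -> O (x - y))
  (OM : forall x y, O x -> O y -> O (x * y))
  (OV : forall x, x != 0 -> O x || O x^-1) (Oproper : exists x, ~~ O x).

Lemma O0 : O 0.
Proof. by rewrite -(subrr 1) OB. Qed.

Definition nonzero := {x : K | x != 0}.
Definition unit_ratio (x y : nonzero) := O (val x / val y) && O (val y / val x).

Lemma div_trans_in (x y z : K) : y != 0 -> O (x / y) -> O (y / z) -> O (x / z).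
Proof. by move=> y0 xy yz; have := OM xy yz; rewrite mulrA divfK. Qed.

Lemma unit_ratio_refl : reflexive unit_ratio.
Proof. by move=> x; rewrite /unit_ratio divff ?O1 // (valP x). Qed.

Lemma unit_ratio_sym : symmetric unit_ratio.
Proof. by move=> x y; rewrite /unit_ratio andbC. Qed.

Lemma unit_ratio_trans : transitive unit_ratio.
Proof.
move=> y x z /andP[xy yx] /andP[yz zy].
by apply/andP; split; apply: div_trans_in (valP y) _ _.
Qed.

Canonical unit_ratio_equiv :=
  EquivRel unit_ratio unit_ratio_refl unit_ratio_sym unit_ratio_trans.

(** The language sees only the valuation ring, so the value group of the generic model is recovered
    as the nonzero elements modulo units, ordered by divisibility. *)
Definition vgroup := {eq_quot unit_ratio_equiv}%qT.
HB.instance Definition _ := Choice.on vgroup.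

Local Notation cl x := (\pi_vgroup x)%qT.

Lemma clP (x y : nonzero) : reflect (cl x = cl y) (unit_ratio x y).
Proof. exact: (@eqquotP _ _ vgroup). Qed.

Lemma repr_cl (x : nonzero) : unit_ratio (repr (cl x)) x.
Proof. by apply/clP; rewrite reprK. Qed.

Lemma clW (P : vgroup -> Prop) : (forall x, P (cl x)) -> forall g, P g.
Proof. by move=> Pcl g; rewrite -[g]reprK. Qed.

Definition nonzero_mul (x y : nonzero) : nonzero :=
  exist (fun x : K => is_true (x != 0)) _ (mulf_neq0 (valP x) (valP y)).
Definition nonzero_inv (x : nonzero) : nonzero :=
  exist (fun x : K => is_true (x != 0)) _ (invr_neq0 (valP x)).
Definition nonzero_one : nonzero := exist (fun x : K => is_true (x != 0)) _ (oner_neq0 K).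

Definition vg_add (g h : vgroup) : vgroup := cl (nonzero_mul (repr g) (repr h)).
Definition vg_opp (g : vgroup) : vgroup := cl (nonzero_inv (repr g)).
Definition vg_le (g h : vgroup) : bool := O (val (repr h) / val (repr g)).

Lemma vg_addE x y : vg_add (cl x) (cl y) = cl (nonzero_mul x y).
Proof.
apply/clP; move: (repr_cl x) (repr_cl y) => /andP[ax bx] /andP[ay by_].
by apply/andP; split; rewrite /= invfM mulrACA OM.
Qed.

Lemma vg_oppE x : vg_opp (cl x) = cl (nonzero_inv x).
Proof.
apply/clP; move: (repr_cl x) => /andP[ax bx].
by apply/andP; split; rewrite /= invrK mulrC.
Qed.

Lemma vg_leE x y : vg_le (cl x) (cl y) = O (val y / val x).
Proof.
move: (repr_cl x) (repr_cl y) => /andP[ax bx] /andP[ay by_].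
apply/idP/idP => H.
  apply: div_trans_in (valP (repr (cl x))) _ ax.
  exact: div_trans_in (valP (repr (cl y))) by_ _.
apply: div_trans_in (valP x) _ bx.
exact: div_trans_in (valP y) ay _.
Qed.

Lemma cl_eq (x y : nonzero) : val x = val y -> cl x = cl y.
Proof. by move/val_inj ->. Qed.

Lemma vg_addA : associative vg_add.
Proof.
elim/clW => x; elim/clW => y; elim/clW => z; rewrite !vg_addE.
by apply: cl_eq; rewrite /= mulrA.
Qed.

Lemma vg_addC : commutative vg_add.
Proof.
by elim/clW => x; elim/clW => y; rewrite !vg_addE; apply: cl_eq; rewrite /= mulrC.
Qed.

Lemma vg_add0 : left_id (cl nonzero_one) vg_add.
Proof. by elim/clW => x; rewrite vg_addE; apply: cl_eq; rewrite /= mul1r. Qed.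

Lemma vg_addN : left_inverse (cl nonzero_one) vg_opp vg_add.
Proof.
elim/clW => x; rewrite vg_oppE vg_addE; apply: cl_eq.
by rewrite /= mulVf // (valP x).
Qed.

HB.instance Definition _ :=
  GRing.isZmodule.Build vgroup vg_addA vg_addC vg_add0 vg_addN.

Lemma vg_le_refl : reflexive vg_le.
Proof. by elim/clW => x; rewrite vg_leE divff // (valP x). Qed.

Lemma vg_le_anti : antisymmetric vg_le.
Proof.
elim/clW => x; elim/clW => y; rewrite !vg_leE => /andP[yx xy].
by apply/clP/andP.
Qed.

Lemma vg_le_trans : transitive vg_le.
Proof.
elim/clW => y; elim/clW => x; elim/clW => z; rewrite !vg_leE => yx zy.
exact: div_trans_in (valP y) zy yx.
Qed.

HB.instance Definition _ := Order.Le_isPOrder.Build ring_display vgroup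
  vg_le_refl vg_le_anti vg_le_trans.

Lemma vgroup_leE x y : ((cl x : vgroup) <= (cl y : vgroup)) = O (val y / val x).
Proof. exact: vg_leE. Qed.

Lemma vgroup_addE x y : (cl x : vgroup) + (cl y : vgroup) = cl (nonzero_mul x y).
Proof. exact: vg_addE. Qed.

Lemma vg_total : total (<=%R : rel vgroup).
Proof.
elim/clW => x; elim/clW => y; rewrite !vgroup_leE.
by rewrite -[val x / _]invf_div OV // mulf_neq0 ?invr_neq0 ?(valP x) ?(valP y).
Qed.

Lemma vg_leD (a b c : vgroup) : a <= b -> a + c <= b + c.
Proof.
elim/clW: a => x; elim/clW: b => y; elim/clW: c => z.
rewrite !vgroup_addE !vgroup_leE /=.
by rewrite invfM mulrACA divff ?mulr1 // (valP z).
Qed.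

Definition vg_oagroup : oagroup := OAGroup vg_total vg_leD.

Definition ring_vfun (x : K) : option vg_oagroup :=
  omap (fun u : nonzero => cl u : vg_oagroup) (insub x).

Lemma ring_vfunE x (x0 : x != 0) :
  ring_vfun x = Some (cl (exist _ x x0 : nonzero) : vg_oagroup).
Proof. by rewrite /ring_vfun insubT /=. Qed.

Lemma ring_vfun0 : ring_vfun 0 = None.
Proof. by rewrite /ring_vfun insubF // eqxx. Qed.

Lemma vle_ring_vfun r t : r != 0 -> vle (ring_vfun r) (ring_vfun t) = O (t / r).
Proof.
move=> r0; rewrite (ring_vfunE r0).
have [->|t0] := eqVneq t 0.
  by rewrite ring_vfun0 mul0r O0.
by rewrite (ring_vfunE t0) /= vgroup_leE.
Qed.

Lemma ring_vfun_None x : ring_vfun x = None <-> x = 0.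
Proof.
split=> [|->]; last exact: ring_vfun0.
by have [//|x0] := eqVneq x 0; rewrite (ring_vfunE x0).
Qed.

Lemma ring_vfunM x y : ring_vfun (x * y) = vadd (ring_vfun x) (ring_vfun y).
Proof.
have [->|x0] := eqVneq x 0; first by rewrite mul0r ring_vfun0.
have [->|y0] := eqVneq y 0.
  by rewrite mulr0 ring_vfun0; case: ring_vfun.
rewrite (ring_vfunE (mulf_neq0 x0 y0)) (ring_vfunE x0) (ring_vfunE y0) /=.
by congr Some; rewrite vgroup_addE; apply: cl_eq.
Qed.

Lemma ring_vfunD x y : vle (ring_vfun x) (ring_vfun (x + y)) ||
  vle (ring_vfun y) (ring_vfun (x + y)).
Proof.
have OD a b : O a -> O b -> O (a + b).
  by move=> Oa Ob; rewrite -[b]opprK OB // -[- b]sub0r OB // O0.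
have [->|x0] := eqVneq x 0.
  by rewrite add0r; apply/orP; right; case: ring_vfun => //= g; apply: lexx.
have [->|y0] := eqVneq y 0.
  by rewrite addr0; apply/orP; left; case: ring_vfun => //= g; apply: lexx.
rewrite !vle_ring_vfun // !mulrDl !divff //.
have /orP[H|] := OV (mulf_neq0 x0 (invr_neq0 y0)).
  by rewrite [X in _ || X]OD // orbT.
by rewrite invf_div => H; rewrite OD.
Qed.

Lemma ring_vfun_surj (g : vg_oagroup) : exists x, ring_vfun x = Some g.
Proof.
exists (val (repr (g : vgroup))); rewrite (ring_vfunE (valP (repr (g : vgroup)))).
congr Some; rewrite -[RHS](@reprK _ vgroup); exact: cl_eq.
Qed.

Lemma ring_vfun_valring x : vle (Some 0) (ring_vfun x) = O x.
Proof.
have [->|x0] := eqVneq x 0; first by rewrite ring_vfun0 /= O0.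
rewrite -[x in RHS]divr1 -vle_ring_vfun ?oner_eq0 //.
by rewrite (ring_vfunE (oner_neq0 K)) (_ : (0 : vg_oagroup) = cl nonzero_one).
Qed.

Lemma ring_vfun_proper : exists x, ~~ vle (Some 0) (ring_vfun x).
Proof. by have [x nx] := Oproper; exists x; rewrite ring_vfun_valring. Qed.

Definition ring_valuation : valuation K :=
  Valuation ring_vfun_None ring_vfunM ring_vfunD ring_vfun_surj ring_vfun_proper.

Lemma valring_ring_valuation : valring ring_valuation =1 O.
Proof. exact: ring_vfun_valring. Qed.

End ValueGroup.

(** * Divisibility in a valuation ring and values of integer polynomials *)

Section ValuationRing.
Variables (K : fieldType) (v : valuation K).
Local Notation O := (valring v).
Implicit Types x y r t : K.

Lemma oag_subr_ge0 (G : oagroup) (g h : G) : (0 <= h - g) = (g <= h).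
Proof.
apply/idP/idP => le.
  by have := oag_leD g le; rewrite add0r subrK.
by have := oag_leD (- g) le; rewrite subrr.
Qed.

Lemma vfun_neq0 x : x != 0 -> exists g, v x = Some g.
Proof.
by move=> x0; case E: (v x) => [g|]; [exists g|case/eqP: x0; apply/(vfun_None v)].
Qed.

Lemma vfunV x g : v x = Some g -> v x^-1 = Some (- g).
Proof.
move=> vx; have x0 : x != 0.
  by apply/eqP => /(vfun_None v); rewrite vx.
have := vfunM v x x^-1; rewrite mulfV // vfun1 vx /=.
by case: (v x^-1) => [h|] //= [gh]; congr Some; apply/eqP; rewrite -addr_eq0 addrC -gh.
Qed.

(** Values are compared below through quotients lying in [O], a form that is expressible in the
    language and passes to the generic model. *)
Lemma vle_div r t : r != 0 -> vle (v r) (v t) = (t / r \in O).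
Proof.
case/vfun_neq0 => g vr; rewrite unfold_in /valring vfunM (vfunV vr) vr.
by case: (v t) => //= h; rewrite oag_subr_ge0.
Qed.

Lemma valring_inv x : x != 0 -> x \in O \/ x^-1 \in O.
Proof.
case/vfun_neq0 => g vx; rewrite !unfold_in /valring (vfunV vx) vx /=.
by have [|/(oag_leD (- g))] := orP (oag_total 0 g); rewrite ?subrr ?sub0r; [left|right].
Qed.

(** The element 0 is excluded because [0^-1] is 0, which lies in [O] although 0 is in the maximal
    ideal. *)
Lemma valmaxE x : x != 0 -> valmax v x = (x^-1 \notin O).
Proof.
case/vfun_neq0 => g vx.
rewrite /valmax !unfold_in /valring (vfunV vx) vx /= -[Some g == _]/(g == 0).
rewrite -[- g]sub0r oag_subr_ge0.
by rewrite eq_le; have [h|h] := orP (oag_total 0 g); rewrite h ?andbT ?andbN.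
Qed.

Lemma valmax_valring x : valmax v x -> x \in O.
Proof. by case/andP. Qed.

Lemma valmaxMr x y : valmax v x -> y \in O -> valmax v (x * y).
Proof.
move=> xm yO; have [->|xy0] := eqVneq (x * y) 0.
  by rewrite /valmax /valring vfun0.
move: (xy0); rewrite mulf_eq0 negb_or => /andP[x0 y0].
move: xm; rewrite !valmaxE //; apply: contra => xyO.
by rewrite (_ : x^-1 = (x * y)^-1 * y) ?rpredM //; field; rewrite ?x0 ?y0.
Qed.

Lemma valmax1 : ~~ valmax v 1.
Proof. by rewrite valmaxE ?oner_eq0 // invr1 rpred1. Qed.

Lemma valmaxB x y : valmax v x -> valmax v y -> valmax v (x - y).
Proof.
move=> xm ym.
have [->|x0] := eqVneq x 0.
  by rewrite sub0r -mulrN1 valmaxMr // rpredN1.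
have [->|y0] := eqVneq y 0; first by rewrite subr0.
have [xyO|yxO] := valring_inv (mulf_neq0 x0 (invr_neq0 y0)).
  rewrite (_ : x - y = y * (x / y - 1)); first by rewrite valmaxMr // rpredB ?rpred1.
  by field; rewrite ?x0 ?y0.
rewrite (_ : x - y = x * (1 - (x / y)^-1)).
  by rewrite valmaxMr // rpredB ?rpred1.
by field; rewrite ?x0 ?y0.
Qed.

Lemma addr1_valmax x : valmax v x -> 1 + x != 0 /\ (1 + x)^-1 \in O.
Proof.
move=> xm; have nm : ~~ valmax v (1 + x).
  by apply: contra valmax1 => /valmaxB /(_ xm); rewrite addrK.
have x1 : 1 + x != 0.
  by apply: contraNneq nm => ->; rewrite /valmax /valring vfun0.
by split=> //; rewrite valmaxE // negbK in nm.
Qed.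

Lemma valmax_neq0 x : ~~ (x^-1 \in O) -> x != 0.
Proof. by apply: contraNneq => ->; rewrite invr0 rpred0. Qed.

Definition int_eval (h : {poly int}) (x : K) : K := (map_poly intr h).[x].

Lemma int_eval_mulX (h : {poly int}) c x :
  int_eval (h * 'X + c%:P) x = int_eval h x * x + c%:~R.
Proof. by rewrite /int_eval rmorphD rmorphM /= map_polyX map_polyC !hornerE. Qed.

Lemma int_eval_Xn_mul k (h : {poly int}) x :
  int_eval ('X^k * h) x = x ^+ k * int_eval h x.
Proof. by rewrite /int_eval rmorphM /= map_polyXn hornerM hornerXn. Qed.

Lemma int_eval_valring h x : x \in O -> int_eval h x \in O.
Proof.
move=> xO; elim/poly_ind: h => [|h c IH].
  by rewrite /int_eval rmorph0 horner0 rpred0.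
by rewrite int_eval_mulX rpredD ?rpredM // rpred_int.
Qed.

(** At small arguments a polynomial is governed by its lowest term, here [a X^k]. *)
Lemma int_poly_lowest (h : {poly int}) : h != 0 ->
  exists k (a : int) (g : {poly int}), a != 0 /\ h = 'X^k * (g * 'X + a%:P).
Proof.
elim/poly_ind: h => [|h c IH]; first by rewrite eqxx.
have [->|c0] := eqVneq c 0; last first.
  by exists 0%N, c, h; rewrite expr0 mul1r.
rewrite addr0 mulf_eq0 polyX_eq0 orbF => /IH[k [a [g [a0 ->]]]].
by exists k.+1, a, g; rewrite exprSr -!mulrA ['X * _]mulrC.
Qed.

Variable p : nat.
Hypotheses (p_pr : prime p) (p_max : valmax v p%:R).

(** Otherwise both [p] and [m] would lie in the maximal ideal, and by Bézout so would 1. *)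
Lemma coprime_unit m : coprime p m -> m%:R^-1 \in O.
Proof.
move=> co; apply: contraT => mN.
have m_max : valmax v m%:R by rewrite valmaxE ?valmax_neq0.
case/(coprimeP _ (prime_gt0 p_pr)): co => -[a b] /= E.
have := valmaxB (valmaxMr p_max (rpred_nat _ a)) (valmaxMr m_max (rpred_nat _ b)).
rewrite -!natrM -natrB; first by rewrite mulnC [(m * _)%N]mulnC E (negPf valmax1).
by rewrite mulnC [(p * _)%N]mulnC ltnW // -subn_gt0 E.
Qed.

(** Only the [p]-part of [a] counts, since the factor prime to [p] is a unit. *)
Lemma int_bounded (a : int) : a != 0 -> exists N, p%:R ^+ N / a%:~R \in O.
Proof.
suff H n : (n > 0)%N -> exists N, p%:R ^+ N / n%:R \in O.
  rewrite -absz_gt0 => /H[N NO]; exists N; move: NO.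
  case: a => n //; rewrite NegzE mulrNz invrN mulrN rpredN.
  by rewrite abszN.
move=> n0; have [m co En] := pfactor_coprime p_pr n0; rewrite En.
move: (logn p n) => k; exists k => {En}.
have [->|pk0] := eqVneq (p%:R ^+ k : K) 0; first by rewrite mul0r rpred0.
by rewrite natrM natrX invfM mulrCA mulfV // mulr1 coprime_unit.
Qed.

End ValuationRing.

(** * Convex subgroups, rank 1 and tightness *)

Section OrderedGroup.
Variable G : oagroup.
Implicit Types a b c d g : G.

Lemma oag_leD2 a b c d : a <= b -> c <= d -> a + c <= b + d.
Proof.
move=> ab cd; apply: le_trans (oag_leD c ab) _.
by rewrite ![b + _]addrC; apply: oag_leD.
Qed.

Lemma oag_muln_ge0 g n : 0 <= g -> 0 <= g *+ n.
Proof.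
move=> g0; elim: n => [|n IH]; first exact: lexx.
by rewrite mulrS -[0]addr0; apply: oag_leD2.
Qed.

Lemma oag_oppr_ge0 g : (0 <= - g) = (g <= 0).
Proof. by rewrite -[- g]sub0r oag_subr_ge0. Qed.

Lemma convex_subgroupMn H g n : convex_subgroup H -> H g -> H (g *+ n).
Proof.
move=> [H0 Hsub _] Hg; elim: n => [|n IH]; first by rewrite mulr0n.
by rewrite mulrSr -[g in _ + g]opprK; apply: (Hsub) => //; rewrite -[- g]sub0r; apply: (Hsub).
Qed.

End OrderedGroup.

Section Rank.
Variables (K : fieldType) (v : valuation K).
Local Notation O := (valring v).
Implicit Types x y c : K.

Lemma vfunX x g n : v x = Some g -> v (x ^+ n) = Some (g *+ n).
Proof.
move=> vx; elim: n => [|n IH]; first by rewrite expr0 vfun1.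
by rewrite exprS vfunM vx IH mulrS.
Qed.

Lemma vle_div_exp x c g h N : v x = Some g -> v c = Some h ->
  (x ^+ N / c \in O) = (h <= g *+ N).
Proof.
move=> vx vc; rewrite -vle_div ?vc ?(vfunX _ vx) //.
by apply/eqP => /(vfun_None v); rewrite vc.
Qed.

(** A nonzero convex subgroup contains some [g > 0]. The last condition puts [v c] below a multiple
    of [g], and the cofinality of [c] puts every value below a multiple of [v c]. *)
Lemma rank1_criterion c : valmax v c -> c != 0 ->
  (forall x, x != 0 -> exists N, c ^+ N / x \in O) ->
  (forall x, x != 0 -> valmax v x -> exists N, x ^+ N / c \in O) ->
  rank1 v.
Proof.
move=> cm c0 cof arch; have [gc vc] := vfun_neq0 v c0.
have nz (h : value_group v) x : v x = Some h -> x != 0.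
  by move=> vx; apply/eqP => /(vfun_None v); rewrite vx.
split.
  by exists gc => g0; move: cm; rewrite /valmax vc g0 eqxx andbF.
move=> H cH; have [H0 Hsub Hc] := cH.
have [[g Hg g0]|no] := pselect (exists2 g, H g & g <> 0); last first.
  left; apply/seteqP; split=> g; last by move=> ->.
  by move=> Hg; apply: contrapT => g0; apply: no; exists g.
right; apply/seteqP; split=> // h _.
have HN a : H a -> H (- a) by move=> Ha; rewrite -sub0r; apply: (Hsub).
have {g Hg g0} [g [Hg g0 gge0]] : exists g, [/\ H g, g <> 0 & 0 <= g].
  have [ge0|le0] := orP (oag_total 0 g); first by exists g.
  exists (- g); split; [exact: HN| |by rewrite oag_oppr_ge0].
  by move/eqP; rewrite oppr_eq0 => /eqP.
have [x vx] := vfun_surj g.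
have xm : valmax v x by rewrite /valmax /valring vx /= gge0; apply/eqP => -[].
have [N] := arch x (nz _ _ vx) xm; rewrite (vle_div_exp _ vx vc) => gcN.
have Hgc : H gc.
  apply: Hc gcN; first exact: convex_subgroupMn.
  by have := valmax_valring cm; rewrite unfold_in /valring vc.
have pos a : 0 <= a -> H a.
  move=> a0; have [y vy] := vfun_surj a.
  have [M] := cof y (nz _ _ vy); rewrite (vle_div_exp _ vc vy) => aM.
  by apply: Hc a0 aM; apply: convex_subgroupMn.
have [/pos //|le0] := orP (oag_total 0 h).
by rewrite -[h]opprK; apply/HN/pos; rewrite oag_oppr_ge0.
Qed.

(** The convex subgroup generated by [v x] is nonzero, so it contains the smallest one, in which
    [v p] lies. *)
Lemma tight_archimedean p x : tight v p -> valmax v x -> x != 0 ->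
  exists N, x ^+ N / p%:R \in O.
Proof.
move=> [H [cH Hn0 Hmin [gp vp Hgp]]] xm x0; have [e vx] := vfun_neq0 v x0.
have e0 : 0 <= e by have := valmax_valring xm; rewrite unfold_in /valring vx.
pose H' : set (value_group v) := [set g | exists N, g <= e *+ N /\ - g <= e *+ N].
have cH' : convex_subgroup H'.
  split.
  - by exists 0%N; rewrite mulr0n oppr0; split; apply: lexx.
  - move=> a b [N [aN NaN]] [M [bM NbM]]; exists (N + M)%N; rewrite mulrnDr.
    by split; [|rewrite opprB addrC]; apply: oag_leD2.
  - move=> a b [N [bN _]] a0 ab; exists N; split; first exact: le_trans bN.
    apply: le_trans (oag_muln_ge0 _ e0).
    by rewrite -oag_oppr_ge0 opprK.
have H'e : H' e.
  exists 1%N; rewrite mulr1n; split; first exact: lexx.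
  by apply: (le_trans _ e0); rewrite -oag_oppr_ge0 opprK.
have [|N [gpN _]] := Hmin H' cH' _ gp Hgp; last by exists N; rewrite (vle_div_exp _ vx vp).
move=> E; move: H'e; rewrite E => /= e00.
by move: xm; rewrite /valmax vx e00 eqxx andbF.
Qed.

End Rank.

(** * Henselianity and powers *)

Section SetSubrings.
Variable K : fieldType.
Implicit Types (R F A : set K) (x y c : K).

Lemma subringB R x y : subring R -> R x -> R y -> R (x - y).
Proof. by case=> _ + _; apply. Qed.

Lemma subringM R x y : subring R -> R x -> R y -> R (x * y).
Proof. by case=> _ _; apply. Qed.

Lemma subring1 R : subring R -> R 1.
Proof. by case. Qed.

Lemma subring0 R : subring R -> R 0.
Proof. by move=> sR; rewrite -(subrr (1 : K)); apply: subringB => //; apply: subring1. Qed.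

Lemma subringN R x : subring R -> R x -> R (- x).
Proof. by move=> sR Rx; rewrite -sub0r; apply: subringB => //; apply: subring0. Qed.

Lemma subringD R x y : subring R -> R x -> R y -> R (x + y).
Proof. by move=> sR Rx Ry; rewrite -[y]opprK; apply: subringB => //; apply: subringN. Qed.

Lemma subringX R x n : subring R -> R x -> R (x ^+ n).
Proof.
move=> sR Rx; elim: n => [|n IH]; first exact: subring1.
by rewrite exprS; apply: subringM.
Qed.

Lemma subring_int R (a : int) : subring R -> R a%:~R.
Proof.
move=> sR; have Rn n : R n%:R.
  elim: n => [|n IH]; first exact: subring0.
  by rewrite -addn1 natrD; apply: subringD => //; apply: subring1.
by case: a => n; [exact: Rn | rewrite NegzE mulrNz; apply: subringN => //; apply: Rn].
Qed.

Lemma subring_int_eval R h x : subring R -> R x -> R (int_eval h x).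
Proof.
move=> sR Rx; elim/poly_ind: h => [|h c IH].
  by rewrite /int_eval rmorph0 horner0; apply: subring0.
by rewrite int_eval_mulX; apply: subringD => //; [apply: subringM|apply: subring_int].
Qed.

Lemma gen_subfieldP A : subfield (gen_subfield A).
Proof.
split; last by move=> x Ax F sF AF; apply: sF.2; apply: Ax.
split; first by move=> F [sF _] _; apply: subring1.
  by move=> x y Ax Ay F sF AF; apply: subringB sF.1 (Ax F sF AF) (Ay F sF AF).
by move=> x y Ax Ay F sF AF; apply: subringM sF.1 (Ax F sF AF) (Ay F sF AF).
Qed.

Lemma sub_gen_subfield A : A `<=` gen_subfield A.
Proof. by move=> x Ax F sF; apply. Qed.

(** Integer numerators and denominators reduce the size of elements of [Q(x)] to that of the values
    [h(x)], which are also the values of the terms of the language. *)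
Lemma gen_subfield1_frac x y : gen_subfield [set x] y ->
  exists h1 h2, int_eval h2 x != 0 /\ y = int_eval h1 x / int_eval h2 x.
Proof.
move=> gen.
have evD h1 h2 : int_eval (h1 - h2) x = int_eval h1 x - int_eval h2 x.
  by rewrite /int_eval rmorphB !hornerE.
have evM h1 h2 : int_eval (h1 * h2) x = int_eval h1 x * int_eval h2 x.
  by rewrite /int_eval rmorphM !hornerE.
have ev1 : int_eval 1 x = 1 by rewrite /int_eval rmorph1 hornerE.
apply: (gen [set y | exists h1 h2,
  int_eval h2 x != 0 /\ y = int_eval h1 x / int_eval h2 x]); last first.
  move=> _ ->; exists 'X, 1; rewrite ev1 oner_eq0 invr1 mulr1.
  by rewrite /int_eval map_polyX hornerX.
split; [split|].
- by exists 1, 1; rewrite ev1 oner_eq0 invr1 mulr1.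
- move=> _ _ [h1 [h2 [h20 ->]]] [k1 [k2 [k20 ->]]].
  exists (h1 * k2 - k1 * h2), (h2 * k2); rewrite evD !evM mulf_neq0 //.
  by split=> //; field; rewrite h20 k20.
- move=> _ _ [h1 [h2 [h20 ->]]] [k1 [k2 [k20 ->]]].
  exists (h1 * k1), (h2 * k2); rewrite !evM mulf_neq0 //.
  by split=> //; field; rewrite h20 k20.
move=> _ [h1 [h2 [h20 ->]]]; have [->|h10] := eqVneq (int_eval h1 x) 0.
  by exists 0, 1; rewrite ev1 oner_eq0 /int_eval rmorph0 horner0 !mul0r invr0.
by exists h2, h1; rewrite invf_div.
Qed.

Lemma sub_relative_alg_closure F : subring F -> F `<=` relative_alg_closure F.
Proof.
move=> sF x Fx; exists ('X - x%:P); rewrite polyXsubC_eq0 root_XsubC eqxx.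
split=> // i; rewrite coefB coefX coefC.
by apply: subringB => //; case: (i == _);
  [apply: subring1|apply: subring0|apply: Fx|apply: subring0].
Qed.

(** If [y] is a root of [f(T)], then [c y] is a root of [f(T / c)]. *)
Lemma relative_alg_closure_mul F c y : subfield F -> F c -> c != 0 ->
  relative_alg_closure F y -> relative_alg_closure F (c * y).
Proof.
move=> [sF Finv] Fc c0 [f [f0 Ff fy]].
exists (\poly_(i < size f) (f`_i * c^-1 ^+ i)); split.
- apply: contraNneq f0 => E; apply/eqP/polyP => i.
  have [lti|gei] := ltnP i (size f); last by rewrite coef0 nth_default.
  have /eqP := congr1 (fun g : {poly K} => g`_i) E.
  rewrite coef_poly lti coef0 mulf_eq0 expf_eq0 invr_eq0 (negPf c0) andbF orbF.
  by move/eqP.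
- move=> i; rewrite coef_poly; case: ifP => _; last exact: subring0.
  by apply: subringM => //; apply: subringX => //; apply: Finv.
move: fy; rewrite /root horner_coef horner_poly => /eqP fy; apply/eqP.
rewrite -[RHS]fy; apply: eq_bigr => i _.
by rewrite exprMn mulrA -[_ * _ * c ^+ i]mulrA -exprMn mulVf // expr1n mulr1.
Qed.

End SetSubrings.

(** * Hensel's lemma over a field generated by one element *)

Section Rational.
Variables (K : fieldType) (v : valuation K).
Implicit Types x y z eta : K.
Local Notation O := (valring v).

Definition int_cofinal (x : K) : Prop :=
  forall h, int_eval h x != 0 -> exists N, x ^+ N / int_eval h x \in O.

(** After division by a power of [T], [z] is a root of some [q] with [q_0] nonzero. A power [x^B]
    clears the denominators of [q]; the equation then shows that [z] divides [x^B q_0] in [O], and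
    [q_0] is an element of [Q(x)], bounded by a power of [x]. *)
Lemma alg_closure_cofinal x z : x != 0 -> x \in O -> int_cofinal x ->
  relative_alg_closure (gen_subfield [set x]) z -> z \in O -> z != 0 ->
  exists N, x ^+ N / z \in O.
Proof.
move=> x0 xO cof [f [f0 Ff fz]] zO z0.
have [m [q]] := multiplicity_XsubC f 0.
rewrite f0 subr0 /= => q0 fq.
have Fq i : gen_subfield [set x] q`_i.
  by have := Ff (i + m)%N; rewrite fq coefMXn ltnNge leq_addl addnK.
have {fz} qz : root q z.
  by move: fz; rewrite fq rootM /root !hornerE expf_eq0 (negPf z0) andbF orbF.
have /choice[N NP] : forall i : nat, exists N, x ^+ N * q`_i \in O.
  move=> i.
  have [h1 [h2 [h20 ->]]] := gen_subfield1_frac (Fq i).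
  have [N NO] := cof h2 h20; exists N.
  by rewrite mulrCA mulrC rpredM ?int_eval_valring // mulrC.
have [N0 N0P] : exists N, x ^+ N / q`_0 \in O.
  have : q`_0 != 0 by move: q0; rewrite /root horner_coef0.
  have [h1 [h2 [h20 ->]]] := gen_subfield1_frac (Fq 0%N) => h120.
  have h10 : int_eval h1 x != 0 by apply: contraNneq h120 => ->; rewrite mul0r.
  have [N1 NO] := cof h1 h10; exists N1.
  by rewrite invf_div mulrCA rpredM ?int_eval_valring.
pose B := (\sum_(i < size q) N i)%N.
have BP (i : 'I_(size q)) : x ^+ B * q`_i \in O.
  by rewrite /B (bigD1 i) //= addnC exprD -mulrA rpredM ?rpredX.
have sq : (0 < size q)%N by rewrite size_poly_gt0; apply: contraNneq q0 => ->; rewrite root0.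
move: qz BP; rewrite /root horner_coef; case E: (size q) sq => [//|s] _.
rewrite big_ord_recl expr0 mulr1 => /eqP /(congr1 (fun u => x ^+ B * u)).
rewrite mulr0 mulrDr => /eqP; rewrite addr_eq0 => /eqP Eq BP.
have [t tO Et] : exists2 t, t \in O & x ^+ B * q`_0 = z * t.
  exists (- \sum_(i < s) x ^+ B * q`_(lift ord0 i) * z ^+ i).
    by rewrite rpredN rpred_sum // => i _; rewrite rpredM ?BP ?rpredX.
  rewrite Eq mulrN !mulr_sumr; congr (- _); apply: eq_bigr => i _.
  by rewrite /= exprS; ring.
exists (B + N0)%N.
have q00 : q`_0 != 0 by move: q0; rewrite /root horner_coef0.
have -> : x ^+ (B + N0) / z = t * (x ^+ N0 / q`_0); last exact: rpredM.
have -> : t = x ^+ B * q`_0 / z by rewrite Et; field.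
by rewrite exprD; field; rewrite ?z0 ?q00.
Qed.

(** Every [y] in [F] is brought into [O] by a power of [x]. With [x^-1] in [R] this power could be
    undone, and [R] would be all of [F]. *)
Lemma coarsening_notin_inv x R : x != 0 -> x \in O -> int_cofinal x ->
  let F := relative_alg_closure (gen_subfield [set x]) in
  valuation_ring F R -> F `&` [set y | valring v y] `<=` R -> ~ R x^-1.
Proof.
move=> x0 xO cof F [sR [RF FR] val] FOR Rx; apply: FR => y Fy.
have sF := gen_subfieldP [set x].
have [->|y0] := eqVneq y 0; first exact: subring0.
have [//|Ry] := val y Fy y0; apply: contrapT => nRy.
have yO : y \notin O by apply/negP => yO; apply: nRy; apply: FOR.
have [yO'|yO'] := valring_inv v y0; first by rewrite yO' in yO.
have [N] := alg_closure_cofinal x0 xO cof (RF _ Ry) yO' (invr_neq0 y0).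
rewrite invrK => xyO; apply: nRy.
have -> : y = (x ^+ N * y) * x^-1 ^+ N.
  by rewrite mulrAC -exprMn mulfV // expr1n mul1r.
apply: subringM => //; last exact: subringX.
apply: FOR; split=> //; apply: relative_alg_closure_mul => //.
  by apply: (@subringX _ (gen_subfield [set x])) sF.1 _; apply: sub_gen_subfield.
exact: expf_neq0.
Qed.

(** For [m = n] the linear coefficient is also [n^2], and division by it leaves a polynomial whose
    derivative at 0 is 1, although [n] itself may be a non-unit. *)
Lemma expr1D_quadratic n m : exists q : {poly int},
  (1 + n%:R * 'X) ^+ m = 1 + (m * n)%:R * 'X + n%:R ^+ 2 * ('X ^+ 2 * q).
Proof.
elim: m => [|m [q IH]].
  by exists 0; rewrite expr0 mul0n mul0r !mulr0 !addr0.
exists (m%:R + q * (1 + n%:R * 'X)).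
by rewrite exprS IH mulSn natrD natrM; ring.
Qed.

Hypothesis prohens : prohenselian_degree1 v.

(* Hensel's lemma is applied to [T + T^2 q - eta], where
   [(1 + n T)^n = 1 + n^2 (T + T^2 q)]. *)
Lemma expr_eq_1D x n eta : valmax v x -> x != 0 -> int_cofinal x ->
  gen_subfield [set x] eta -> eta / x \in O ->
  exists b, b ^+ n = 1 + n%:R ^+ 2 * eta.
Proof.
move=> xm x0 cof Qeta etaO.
have xO := valmax_valring xm.
have [R [vR hR FOR]] := prohens xm.
have nRx := coarsening_notin_inv x0 xO cof vR FOR.
have [sR _ _] := vR; have sF := (gen_subfieldP [set x]).1.
have QR y : gen_subfield [set x] y -> y \in O -> R y.
  by move=> Qy yO; apply: FOR; split=> //; apply: sub_relative_alg_closure.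
have Reta : R eta.
  apply: QR => //; rewrite (_ : eta = x * (eta / x)); first exact: rpredM.
  by field.
have Retax : R (eta / x).
  apply: QR => //; apply: (subringM sF) => //.
  by apply: (gen_subfieldP _).2; apply: sub_gen_subfield.
have [q Eq] := expr1D_quadratic n n.
pose f : {poly K} := 'X + 'X^2 * map_poly intr q - eta%:P.
have [b [_ fb _]] : exists b, [/\ R b, f.[b] = 0 & maximal_ideal R (b - 0)].
  (* The approximate root is 0, where the polynomial takes the value [- eta] and its derivative is
     1. *)
  apply: hR; last 1 first.
  - rewrite /f !derivE !hornerE /= expr0n mul0r addr0.
    by case=> _ []; rewrite addr0 subr0 invr1 oner_neq0; split=> //; apply: subring1.
  - move=> i; have -> : f = map_poly intr ('X + 'X^2 * q) - eta%:P.
      by rewrite /f rmorphD rmorphM /= map_polyXn map_polyX.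
    rewrite coefB coef_map coefC; apply: subringB => //; first exact: subring_int.
    by case: eqP => // _; apply: subring0.
  - exact: subring0.
  rewrite /f !hornerE /= ?expr0n ?mul0r ?add0r; split; first exact: subringN.
  (* If [eta] were a unit of [R], then so would be [x], because [x^-1 = eta^-1 (eta / x)]. *)
  case; rewrite oppr_eq0 invrN => eta0 Rinv; apply: nRx.
  rewrite (_ : x^-1 = - (- eta^-1 * (eta / x))); last by field; rewrite eta0 x0.
  by apply: subringN => //; apply: subringM.
exists (1 + n%:R * b).
have /(congr1 (fun h : {poly int} => int_eval h b)) := Eq.
rewrite /int_eval !(rmorphD, rmorphM, rmorphXn, rmorph_nat, rmorph1) /=.
rewrite !map_polyX !hornerE.
rewrite -!polyC_natr !hornerE /= => ->.
move/eqP: fb; rewrite /f !hornerE /= subr_eq0 => /eqP <-; ring.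
Qed.
End Rational.

(** * Transfer of quantifier-free formulas *)

Section Transfer.
Variables (K : fieldType) (v : valuation K) (p : nat).
Hypotheses (char_K : [pchar K] =i pred0) (p_pr : prime p)
  (p_max : valmax v p%:R) (prohens : prohenselian_degree1 v).
Local Notation O := (valring v).
Implicit Types x y z : K.

Lemma natr_neq0 n : (0 < n)%N -> n%:R != 0 :> K.
Proof.
by move=> n0; have /pcharf0P -> := char_K; rewrite -lt0n.
Qed.

Lemma intr_neq0 (a : int) : a != 0 -> a%:~R != 0 :> K.
Proof.
rewrite -absz_gt0 => /natr_neq0.
by case: a => n; rewrite ?NegzE ?mulrNz ?oppr_eq0.
Qed.

(** What [p] and the infinitesimals have in common. The condition on [x / p] lets powers of [x]
    absorb the denominators that come from integers. *)
Definition admissible x : Prop :=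
  [/\ x != 0, valmax v x, x / p%:R \in O & int_cofinal v x].

Lemma admissible_p : admissible p%:R.
Proof.
have p0 := natr_neq0 (prime_gt0 p_pr).
split; rewrite ?divff ?rpred1 // => h.
have -> : int_eval h p%:R = (h.[p%:R])%:~R :> K.
  by rewrite -(rmorph_nat intr) /int_eval horner_map.
by move=> h0; apply: int_bounded => //; apply: contraNneq h0 => ->.
Qed.

(** For [h = X^k (a + X g)], the element [x g(x) / a] is in the maximal ideal, so [h(x)] is [a x^k]
    up to a unit; one further factor [x] outweighs [a]. *)
Lemma admissible_infinitesimal x : x != 0 ->
  (forall N, p%:R ^+ N / x \notin O) -> admissible x.
Proof.
move=> x0 inf; have p0 := natr_neq0 (prime_gt0 p_pr).
have xpO N : x / p%:R ^+ N \in O.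
  have [//|] := valring_inv v (mulf_neq0 x0 (invr_neq0 (expf_neq0 N p0))).
  by rewrite invf_div (negPf (inf N)).
have xm : valmax v x.
  rewrite (_ : x = p%:R * (x / p%:R ^+ 1)); first exact: valmaxMr.
  by rewrite expr1; field.
split=> //; first exact: (xpO 1%N).
move=> h hx0.
have h0 : h != 0 by apply: contraNneq hx0 => ->; rewrite /int_eval rmorph0 horner0.
have [k [a [g [a0 E]]]] := int_poly_lowest h0.
have [N NO] := int_bounded p_pr p_max a0.
have aK := intr_neq0 a0.
have xa : valmax v (x / a%:~R * int_eval g x).
  rewrite (_ : x / a%:~R = p%:R * ((x / p%:R ^+ N.+1) * (p%:R ^+ N / a%:~R))).
    rewrite -mulrA; apply: valmaxMr => //.
    by apply/rpredM/int_eval_valring/valmax_valring/xm; apply: rpredM (xpO _) NO.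
  by rewrite exprS; field; rewrite aK p0 expf_neq0.
have [u0 uO] := addr1_valmax xa.
exists k.+1; rewrite (_ : _ / _ = x / p%:R ^+ N * (p%:R ^+ N / a%:~R) *
  (1 + x / a%:~R * int_eval g x)^-1).
  by apply/rpredM/uO; apply: rpredM (xpO _) NO.
have -> : int_eval h x = x ^+ k * (a%:~R * (1 + x / a%:~R * int_eval g x)).
  by rewrite E int_eval_Xn_mul int_eval_mulX; congr (_ * _); field.
rewrite exprS; move: u0; set w := 1 + _ => u0.
by field; rewrite aK u0 !expf_neq0.
Qed.

(* For [h = X^k (a + X g)], the factor [1 + x^M g(x^M) / a] is an [n]-th power
   as soon as [x^M / (a n^2)] lies in [x O]. *)
Lemma int_eval_expr (h : {poly int}) n : h != 0 -> (0 < n)%N ->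
  exists2 a : int, a != 0 & exists2 m, (0 < m)%N &
    forall x M, admissible x -> (0 < M)%N -> (m %| M)%N ->
      exists2 u, u != 0 & int_eval h (x ^+ M) = a%:~R * u ^+ n.
Proof.
move=> h0 n0; have [k [a [g [a0 E]]]] := int_poly_lowest h0.
exists a => //.
have nn0 : (n%:R : K) != 0 := natr_neq0 n0.
have an0 : a * n%:Z ^+ 2 != 0 by rewrite mulf_neq0 ?expf_neq0 // -lt0n.
have [N NO] := int_bounded p_pr p_max an0.
(* The factor [n] makes [x^(M k)] an [n]-th power. The factor [N.+1] gives [M > N], so that [N]
   factors [x / p] absorb the denominator [a n^2] and one factor [x] remains for Hensel's lemma. *)
exists (n * N.+1)%N; first by rewrite muln_gt0 n0.
move=> x M [x0 xm xpO cof] M0 /dvdnP[j Mj].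
have aK := intr_neq0 a0; have p0 := natr_neq0 (prime_gt0 p_pr).
have xO := valmax_valring xm.
have [L ML] : exists L, M = (L + N).+1.
  exists (M - N.+1)%N; rewrite -addnS subnK // Mj.
  have j0 : (0 < j)%N by move: M0; rewrite Mj; case: (j).
  by rewrite mulnA leq_pmull // muln_gt0 j0.
pose eta := x ^+ M * int_eval g (x ^+ M) / (a%:~R * n%:R ^+ 2).
have etaO : eta / x \in O.
  rewrite (_ : eta / x = x ^+ L * (x / p%:R) ^+ N * (p%:R ^+ N / (a * n%:Z ^+ 2)%:~R)
     * int_eval g (x ^+ M)).
    apply/rpredM/int_eval_valring/rpredX/xO; apply: rpredM NO.
    by apply: rpredM; apply: rpredX.
  rewrite /eta ML exprS exprD expr_div_n intrM rmorphXn /=.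
  by field; rewrite x0 aK nn0 expf_neq0.
have Qeta : gen_subfield [set x] eta.
  have [sF invF] := gen_subfieldP [set x].
  have Qx := @sub_gen_subfield _ [set x] x erefl.
  have QxM := subringX M sF Qx.
  apply: (subringM sF); first exact: (subringM sF QxM (subring_int_eval g sF QxM)).
  apply: invF; apply: (subringM sF); first exact: (subring_int _ sF).
  by rewrite -natrX -(rmorph_nat intr); exact: (subring_int _ sF).
have [b bn] := expr_eq_1D prohens n xm x0 cof Qeta etaO.
have bm : valmax v (n%:R ^+ 2 * eta).
  rewrite (_ : _ * eta = x * (n%:R ^+ 2 * (eta / x))); last by field.
  by apply: valmaxMr => //; apply: rpredM => //; rewrite rpredX // rpred_nat.
have b0 : b != 0.
  have [+ _] := addr1_valmax bm; rewrite -bn expf_eq0 negb_and.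
  by rewrite n0.
exists (x ^+ (N.+1 * j * k) * b); first by rewrite mulf_neq0 ?expf_neq0.
rewrite exprMn bn -exprM E int_eval_Xn_mul int_eval_mulX -exprM {1}Mj.
rewrite (_ : (j * (n * N.+1) * k = N.+1 * j * k * n)%N); last by ring.
rewrite /eta; field; rewrite aK nn0 //.
Qed.

Lemma term_poly (t : term L_Mac 1) :
  exists h, forall e : 'I_1 -> mac_structure v, eval e t = int_eval h (e ord0).
Proof.
elim: t => [i|[] a IH] /=.
- by exists 'X => e; rewrite /int_eval map_polyX hornerX (ord1 i).
- have [h1 h1P] := IH ord0; have [h2 h2P] := IH ord_max.
  by exists (h1 + h2) => e; rewrite /= h1P h2P /int_eval rmorphD hornerD.
- have [h1 h1P] := IH ord0.
  by exists (- h1) => e; rewrite /= h1P /int_eval rmorphN hornerN.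
- have [h1 h1P] := IH ord0; have [h2 h2P] := IH ord_max.
  by exists (h1 * h2) => e; rewrite /= h1P h2P /int_eval rmorphM hornerM.
- by exists 0 => e; rewrite /int_eval rmorph0 horner0.
- by exists 1 => e; rewrite /int_eval rmorph1 hornerC.
Qed.

(** Atoms have the same truth value at all the powers considered: distinct polynomials take distinct
    values, integer polynomials take values in [O], and a nonzero [h] takes an [l]-th power as value
    exactly when the integer [a], which depends on [h] and [l] only, is an [l]-th power in [K]. *)
Lemma qf_transfer (phi : formula L_Mac 1) : quantifier_free phi ->
  exists2 m, (0 < m)%N & forall M, (0 < M)%N -> (m %| M)%N ->
    forall x y, admissible x -> admissible y ->
    @sat _ (mac_structure v) _ phi (fun=> x ^+ M) <->
    @sat _ (mac_structure v) _ phi (fun=> y ^+ M).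
Proof.
have combine (P1 P2 : nat -> Prop) :
    (exists2 m, (0 < m)%N & forall M, (0 < M)%N -> (m %| M)%N -> P1 M) ->
    (exists2 m, (0 < m)%N & forall M, (0 < M)%N -> (m %| M)%N -> P2 M) ->
    exists2 m, (0 < m)%N & forall M, (0 < M)%N -> (m %| M)%N -> P1 M /\ P2 M.
  move=> [m1 m10 H1] [m2 m20 H2]; exists (m1 * m2)%N; first by rewrite muln_gt0 m10.
  move=> M M0 mM; split; [apply: H1|apply: H2] => //; apply: dvdn_trans mM.
    exact: dvdn_mulr.
  exact: dvdn_mull.
(* The number of variables is generalized for the induction; as no quantifier occurs, it stays 1. *)
have gen n (psi : formula L_Mac n) : forall E : n = 1%N, quantifier_free psi ->
  exists2 m, (0 < m)%N & forall M, (0 < M)%N -> (m %| M)%N ->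
    forall x y, admissible x -> admissible y ->
    @sat _ (mac_structure v) _ psi (fun=> x ^+ M) <->
    @sat _ (mac_structure v) _ psi (fun=> y ^+ M).
  elim: psi => {n phi} //= n.
  - move=> s t E; subst n => _.
    have [h1 h1P] := term_poly s; have [h2 h2P] := term_poly t.
    have [d0|h0] := eqVneq (h1 - h2) 0.
      exists 1%N => // M _ _ x y _ _; rewrite !h1P !h2P.
      by move/eqP: d0; rewrite subr_eq0 => /eqP ->.
    (* With exponent 1, the factorization only serves to show that [h1 - h2] does not vanish. *)
    have [a a0 [m m0 mP]] := @int_eval_expr _ 1 h0 isT.
    exists m => // M M0 mM x y ax ay; rewrite !h1P !h2P.
    suff neq z : admissible z -> int_eval h1 (z ^+ M) <> int_eval h2 (z ^+ M).
      by split=> /neq; case.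
    move=> az; have [u u0 E] := mP z M az M0 mM.
    move/eqP; rewrite -subr_eq0 -hornerN -hornerD -rmorphB -/(int_eval _ _) E.
    by rewrite mulf_eq0 expf_eq0 (negPf u0) andbF orbF; apply/negP/intr_neq0.
  - move=> R b E; subst n => _; case: R b => [|l l1] b /=.
      have [h hP] := term_poly (b ord0).
      exists 1%N => // M _ _ x y [_ xm _ _] [_ ym _ _]; rewrite !hP.
      by split=> _; apply: int_eval_valring; rewrite rpredX // valmax_valring.
    have [h hP] := term_poly (b ord0).
    have [hE|h0] := eqVneq h 0.
      exists 1%N => // M _ _ x y [_ xm _ _] [_ ym _ _]; rewrite !hP.
      by rewrite hE /int_eval rmorph0 !horner0.
    have [a a0 [m m0 mP]] := @int_eval_expr h l h0 (ltnW l1).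
    exists m => // M M0 mM x y ax ay; rewrite !hP.
    suff pow z : admissible z ->
      (int_eval h (z ^+ M) != 0 /\ (exists w, int_eval h (z ^+ M) = w ^+ l)) <->
      (exists w : K, a%:~R = w ^+ l) by rewrite !pow.
    move=> az; have [u u0 ->] := mP z M az M0 mM; have aK := intr_neq0 a0.
    split=> [[_ [w Ew]]|[w Ew]].
      exists (w / u); rewrite expr_div_n -Ew mulfK // expf_neq0 //.
    rewrite mulf_neq0 ?expf_neq0 //; split=> //.
    by exists (w * u); rewrite Ew exprMn.
  - move=> a IH E qa; have [m m0 mP] := IH E qa; exists m => // M M0 mM x y ax ay.
    by rewrite (mP M M0 mM x y ax ay).
  - move=> a IHa b IHb E /andP[/(IHa E) Ha /(IHb E) Hb].
    have [m m0 mP] := combine _ _ Ha Hb.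
    exists m => // M M0 mM x y ax ay; have [Pa Pb] := mP M M0 mM.
    by rewrite (Pa x y ax ay) (Pb x y ax ay).
  move=> a IHa b IHb E /andP[/(IHa E) Ha /(IHb E) Hb].
  have [m m0 mP] := combine _ _ Ha Hb.
  exists m => // M M0 mM x y ax ay; have [Pa Pb] := mP M M0 mM.
  by rewrite (Pa x y ax ay) (Pb x y ax ay).
exact: gen.
Qed.

Hypothesis qe : admits_QE (Th (mac_structure v)).

Lemma infinitesimal_nonisolated (psi : formula L_Mac 1) x :
  @sat _ (mac_structure v) _ psi (fun=> x) ->
  exists2 y, @sat _ (mac_structure v) _ psi (fun=> y) &
    y = 0 \/ exists N, p%:R ^+ N / y \in O.
Proof.
move=> psix; have [x0|x0] := eqVneq x 0; first by exists x => //; left.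
have [fin|inf] := pselect (exists N, p%:R ^+ N / x \in O).
  by exists x => //; right.
have ax : admissible x.
  apply: admissible_infinitesimal => // N; apply/negP => NO; apply: inf.
  by exists N.
(* Under both quantifiers the indices 0, 1, 2 are the quotient [w], [y] and [z]; the inner part says
   [z = w y] with [w] in [O]. *)
pose theta : formula L_Mac 1 :=
  Ex (And (rename (fun=> ord0) psi)
    (And (Not (Eq (Var L_Mac ord0) (@App L_Mac 2 MZero (fun=> Var L_Mac ord0))))
      (Ex (And (@Rel L_Mac 3 MO (fun=> Var L_Mac ord0))
         (Eq (Var L_Mac (lift ord0 (lift ord0 ord0))) (@App L_Mac 3 MMul
            (fun i => Var L_Mac (if i == ord0 then ord0 else lift ord0 ord0)))))))).
have thetaP z : @sat _ (mac_structure v) _ theta (fun=> z) <->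
  exists y, [/\ @sat _ (mac_structure v) _ psi (fun=> y), y != 0 & z / y \in O].
  rewrite /theta /= -propeqE; apply: eq_exists => y; rewrite sat_rename.
  rewrite (_ : _ \o _ = fun=> y); last first.
    by apply: funext => i; rewrite /= env_cons0.
  rewrite env_cons0; apply/propext; split=> [[psiy [y0 [w]]]|[psiy y0 zyO]].
    rewrite !env_consS !env_cons0 => -[wO zE].
    by split=> //; [apply/eqP|rewrite zE mulfK //; apply/eqP].
  split=> //; split; first exact/eqP.
  by exists (z / y); rewrite !env_consS !env_cons0 divfK.
have [chi [qchi chiP]] := qe theta.
have {}chiP z : @sat _ (mac_structure v) _ theta (fun=> z) <->
     @sat _ (mac_structure v) _ chi (fun=> z).
  exact: (chiP (mac_structure v)).
have [m m0 mP] := qf_transfer qchi.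
(* At [x^m] the formula [theta] is witnessed by [x], because [x^(m - 1)] lies in [O]. *)
have := mP m m0 (dvdnn m) x p%:R ax admissible_p.
rewrite -!chiP !thetaP => -[+ _]; case.
  exists x; split=> //; case: (m) m0 => // m' _.
  by rewrite exprS mulrAC mulfV // mul1r rpredX //; case: ax => _ /valmax_valring.
by move=> y [psiy y0 yO]; exists y => //; right; exists m.
Qed.
End Transfer.

(** * The field of a generic filter *)

Section GenericField.
Variables (K : fieldType) (v : valuation K).
Local Notation O := (valring v).
Local Notation M := (mac_structure v).

Fixpoint pow_term k (t : term L_Mac k) n : term L_Mac k :=
  if n is m.+1 then
    @App L_Mac k MMul (fun i => if i == ord0 then t else pow_term t m)
  else @App L_Mac k MOne (fun=> t).

Lemma eval_pow_term k (t : term L_Mac k) n (e : 'I_k -> M) :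
  eval e (pow_term t n) = (eval e t : K) ^+ n.
Proof. by elim: n => [|n IH] //=; rewrite exprS /= IH. Qed.

Variable F : set (nat -> M) -> Prop.
Hypothesis gF : generic_filter F.
Implicit Types e : nat -> K.

Definition gen_eq (n m : nat) : bool := `[< F [set e | e n = e m] >].

Lemma gen_eq_refl : reflexive gen_eq.
Proof. by move=> n; apply/asboolP; apply: gen_sub gF _ _ _ (gen_setT gF). Qed.

Lemma gen_eq_sym : symmetric gen_eq.
Proof.
by move=> n m; apply/asboolP/asboolP; apply: gen_sub gF _ _ _ => e /= ->.
Qed.

Lemma gen_eq_trans : transitive gen_eq.
Proof.
move=> m n k /asboolP nm /asboolP mk; apply/asboolP.
by apply: gen_sub gF _ _ _ (gen_setI gF nm mk) => e /= [-> ->].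
Qed.

Canonical gen_equiv := EquivRel gen_eq gen_eq_refl gen_eq_sym gen_eq_trans.

(** A number [n] stands for the coordinate function [e |-> e n]; two of them are identified when
    they agree on a set of the filter. *)
Definition gfield := {eq_quot gen_equiv}%qT.
HB.instance Definition _ := Choice.on gfield.
Implicit Types x y z : gfield.

Definition coord (x : gfield) (e : nat -> K) : K := e (repr x).

Lemma coord_pi n : F [set e | coord (\pi_gfield n)%qT e = e n].
Proof.
suff /asboolP : gen_eq (repr (\pi_gfield n)%qT) n by [].
by apply/(@eqquotP _ _ gfield); rewrite reprK.
Qed.

Lemma coord_eq x y : F [set e | coord x e = coord y e] <-> x = y.
Proof.
split=> [Fxy|->]; last exact: gen_sub gF _ _ _ (gen_setT gF).
rewrite -[x]reprK -[y]reprK; apply/(@eqquotP _ _ gfield).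
exact/asboolP.
Qed.

Lemma coord_term k (t : term L_Mac k) (E : 'I_k -> gfield) :
  exists z, F [set e | coord z e = eval (fun i => coord (E i) e : M) t].
Proof.
have [m Fm] := generic_term gF t (fun i => repr (E i)).
exists (\pi_gfield m)%qT.
by apply: gen_sub gF _ _ _ (gen_setI gF Fm (coord_pi m)) => e [/= em ->].
Qed.

Lemma gadd_subproof x y : exists z, F [set e | coord z e = coord x e + coord y e].
Proof.
have [z Fz] := coord_term (@App L_Mac 2 MAdd (@Var L_Mac 2))
  (fun i : 'I_2 => if i == ord0 then x else y).
by exists z; apply: gen_sub gF _ _ _ Fz.
Qed.

Lemma gopp_subproof x : exists z, F [set e | coord z e = - coord x e].
Proof.
have [z Fz] := coord_term (@App L_Mac 1 MOpp (@Var L_Mac 1)) (fun=> x).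
by exists z; apply: gen_sub gF _ _ _ Fz.
Qed.

Lemma gmul_subproof x y : exists z, F [set e | coord z e = coord x e * coord y e].
Proof.
have [z Fz] := coord_term (@App L_Mac 2 MMul (@Var L_Mac 2))
  (fun i : 'I_2 => if i == ord0 then x else y).
by exists z; apply: gen_sub gF _ _ _ Fz.
Qed.

Lemma gzero_subproof : exists z, F [set e | coord z e = 0].
Proof.
have [z Fz] := coord_term (@App L_Mac 1 MZero (fun=> Var L_Mac ord0))
  (fun=> \pi_gfield 0%N)%qT.
by exists z; apply: gen_sub gF _ _ _ Fz.
Qed.

Lemma gone_subproof : exists z, F [set e | coord z e = 1].
Proof.
have [z Fz] := coord_term (@App L_Mac 1 MOne (fun=> Var L_Mac ord0))
  (fun=> \pi_gfield 0%N)%qT.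
by exists z; apply: gen_sub gF _ _ _ Fz.
Qed.

(** Inversion is not a symbol of the language, so the inverse arises as a generic witness of its
    definition, with the convention [0^-1 = 0] included. *)
Lemma ginv_subproof x : exists z, F [set e | coord z e = (coord x e)^-1].
Proof.
pose v0 : term L_Mac 2 := Var L_Mac ord0.
pose v1 : term L_Mac 2 := Var L_Mac (lift ord0 ord0).
pose zero : term L_Mac 2 := @App L_Mac 2 MZero (fun=> v0).
pose one : term L_Mac 2 := @App L_Mac 2 MOne (fun=> v0).
have [|m Fm] := gen_witness gF
    (phi := Or (And (Eq v0 zero) (Eq v1 zero))
       (Eq (@App L_Mac 2 MMul (fun i => if i == ord0 then v0 else v1)) one))
    (r := fun=> repr x).
  apply: gen_sub gF _ _ _ (gen_setT gF) => e _.
  exists (coord x e)^-1; rewrite /= env_cons0 env_consS /= -/(coord x e).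
  have [->|x0] := eqVneq (coord x e) 0; first by left; rewrite invr0.
  by right; rewrite mulVf.
exists (\pi_gfield m)%qT.
apply: gen_sub gF _ _ _ (gen_setI gF Fm (coord_pi m)) => e [/= + ->].
rewrite env_cons0 env_consS /= -/(coord x e).
case=> [[-> ->]|]; first by rewrite invr0.
move=> xy; have x0 : coord x e != 0.
  apply/eqP => x0; move/eqP: xy; rewrite x0 mulr0 eq_sym; exact/negP/oner_neq0.
by rewrite -[RHS]mul1r -xy mulfK.
Qed.

Definition gadd x y := sval (cid (gadd_subproof x y)).
Definition gopp x := sval (cid (gopp_subproof x)).
Definition gmul x y := sval (cid (gmul_subproof x y)).
Definition ginv x := sval (cid (ginv_subproof x)).
Definition gzero := sval (cid gzero_subproof).
Definition gone := sval (cid gone_subproof).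

Lemma gaddP x y : F [set e | coord (gadd x y) e = coord x e + coord y e].
Proof. exact: svalP (cid (gadd_subproof x y)). Qed.
Lemma goppP x : F [set e | coord (gopp x) e = - coord x e].
Proof. exact: svalP (cid (gopp_subproof x)). Qed.
Lemma gmulP x y : F [set e | coord (gmul x y) e = coord x e * coord y e].
Proof. exact: svalP (cid (gmul_subproof x y)). Qed.
Lemma ginvP x : F [set e | coord (ginv x) e = (coord x e)^-1].
Proof. exact: svalP (cid (ginv_subproof x)). Qed.
Lemma gzeroP : F [set e | coord gzero e = 0].
Proof. exact: svalP (cid gzero_subproof). Qed.
Lemma goneP : F [set e | coord gone e = 1].
Proof. exact: svalP (cid gone_subproof). Qed.

Lemma gaddA : associative gadd.
Proof.
move=> x y z; apply/coord_eq.
apply: gen_sub gF _ _ _ (gen_setI gF (gen_setI gF (gaddP x (gadd y z)) (gaddP y z))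
  (gen_setI gF (gaddP (gadd x y) z) (gaddP x y))) => e [[/= -> ->] [-> ->]].
exact: addrA.
Qed.

Lemma gaddC : commutative gadd.
Proof.
move=> x y; apply/coord_eq.
apply: gen_sub gF _ _ _ (gen_setI gF (gaddP x y) (gaddP y x)) => e [/= -> ->].
exact: addrC.
Qed.

Lemma gadd0 : left_id gzero gadd.
Proof.
move=> x; apply/coord_eq.
apply: gen_sub gF _ _ _ (gen_setI gF (gaddP gzero x) gzeroP) => e [/= -> ->].
exact: add0r.
Qed.

Lemma gaddN : left_inverse gzero gopp gadd.
Proof.
move=> x; apply/coord_eq; apply: gen_sub gF _ _ _
  (gen_setI gF (gen_setI gF (gaddP (gopp x) x) (goppP x)) gzeroP) => e [[/= -> ->] ->].
exact: addNr.
Qed.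

HB.instance Definition _ := GRing.isZmodule.Build gfield gaddA gaddC gadd0 gaddN.

Lemma gmulA : associative gmul.
Proof.
move=> x y z; apply/coord_eq.
apply: gen_sub gF _ _ _ (gen_setI gF (gen_setI gF (gmulP x (gmul y z)) (gmulP y z))
  (gen_setI gF (gmulP (gmul x y) z) (gmulP x y))) => e [[/= -> ->] [-> ->]].
exact: mulrA.
Qed.

Lemma gmulC : commutative gmul.
Proof.
move=> x y; apply/coord_eq.
apply: gen_sub gF _ _ _ (gen_setI gF (gmulP x y) (gmulP y x)) => e [/= -> ->].
exact: mulrC.
Qed.

Lemma gmul1 : left_id gone gmul.
Proof.
move=> x; apply/coord_eq.
apply: gen_sub gF _ _ _ (gen_setI gF (gmulP gone x) goneP) => e [/= -> ->].
exact: mul1r.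
Qed.

Lemma gmulD : left_distributive gmul gadd.
Proof.
move=> x y z; apply/coord_eq; apply: gen_sub gF _ _ _
  (gen_setI gF (gen_setI gF (gmulP (gadd x y) z) (gaddP x y))
    (gen_setI gF (gaddP (gmul x z) (gmul y z))
      (gen_setI gF (gmulP x z) (gmulP y z)))) => e [[/= -> ->] [-> [-> ->]]].
exact: mulrDl.
Qed.

Lemma gone_neq0 : gone != gzero.
Proof.
apply/eqP => /coord_eq F10; apply: (gen_set0 gF).
apply: gen_sub gF _ _ _ (gen_setI gF F10 (gen_setI gF gzeroP goneP)) => e [/= -> [-> ]].
by move/eqP; rewrite eq_sym oner_eq0.
Qed.

HB.instance Definition _ :=
  GRing.Zmodule_isComNzRing.Build gfield gmulA gmulC gmul1 gmulD gone_neq0.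

Lemma coord0 : F [set e | coord 0 e = 0]. Proof. exact: gzeroP. Qed.

Lemma coord_neq0 x : x != 0 <-> F [set e | coord x e != 0].
Proof.
split=> [x0|Fx0].
  have [Fx|Fx] := gen_decide gF (Eq (Var L_Mac ord0) (Var L_Mac ord_max))
      (fun i : 'I_2 => if i == ord0 then repr x else repr (0 : gfield)).
    by case/eqP: x0; apply/coord_eq; apply: gen_sub gF _ _ _ Fx.
  by apply: gen_sub gF _ _ _ (gen_setI gF Fx coord0) => e [/= xe <-]; apply/eqP.
apply/eqP => x0; apply: (gen_set0 gF); move: Fx0; rewrite x0 => Fx0.
by apply: gen_sub gF _ _ _ (gen_setI gF Fx0 coord0) => e [/= /eqP].
Qed.

Lemma gmulV x : x != 0 -> gmul (ginv x) x = 1.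
Proof.
move/coord_neq0 => x0; apply/coord_eq; apply: gen_sub gF _ _ _
  (gen_setI gF (gen_setI gF (gmulP (ginv x) x) (ginvP x)) (gen_setI gF goneP x0))
  => e [[/= -> ->] [-> xe0]].
exact: mulVf.
Qed.

Lemma ginv0 : ginv 0 = 0.
Proof.
apply/coord_eq.
apply: gen_sub gF _ _ _ (gen_setI gF (ginvP 0) coord0) => e [/= -> ->].
exact: invr0.
Qed.

HB.instance Definition _ := GRing.ComNzRing_isField.Build gfield gmulV ginv0.

Lemma coordX x n : F [set e | coord (x ^+ n) e = coord x e ^+ n].
Proof.
elim: n => [|n IH]; first exact: goneP.
apply: gen_sub gF _ _ _ (gen_setI gF IH (gmulP x (x ^+ n))) => e [/= IHe E].
by rewrite !exprS E IHe.
Qed.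

Lemma coord_nat n : F [set e | coord n%:R e = n%:R].
Proof.
elim: n => [|n IH]; first exact: coord0.
rewrite -addn1 natrD.
apply: gen_sub gF _ _ _ (gen_setI gF IH (gen_setI gF goneP (gaddP n%:R 1)))
  => e [/= IHe [E1 E]].
by rewrite natrD -IHe -E1 -E.
Qed.

Definition gring (x : gfield) : bool := `[< F [set e | coord x e \in O] >].

Lemma coord_div_gring x y :
  F [set e | coord x e / coord y e \in O] -> gring (x / y).
Proof.
move=> Fxy; apply/asboolP; apply: gen_sub gF _ _ _
  (gen_setI gF (gen_setI gF (gmulP x y^-1) (ginvP y)) Fxy) => e [[/= E1 E2]].
by rewrite -E2 -E1.
Qed.

Lemma gring1 : gring 1.
Proof.
apply/asboolP; apply: gen_sub gF _ _ _ goneP => e /= E.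
by rewrite [coord _ _]E rpred1.
Qed.

Lemma gringB x y : gring x -> gring y -> gring (x - y).
Proof.
move=> /asboolP Fx /asboolP Fy; apply/asboolP; apply: gen_sub gF _ _ _
  (gen_setI gF (gen_setI gF (gaddP x (- y)) (goppP y)) (gen_setI gF Fx Fy))
  => e [[/= E1 E2] [xe ye]].
by rewrite [coord _ _]E1 E2 rpredB.
Qed.

Lemma gringM x y : gring x -> gring y -> gring (x * y).
Proof.
move=> /asboolP Fx /asboolP Fy; apply/asboolP; apply: gen_sub gF _ _ _
  (gen_setI gF (gmulP x y) (gen_setI gF Fx Fy)) => e [/= E [xe ye]].
by rewrite [coord _ _]E rpredM.
Qed.

Lemma gring_decide x :
  gring x \/ F [set e | coord x e \notin O].
Proof.
have [Fx|Fx] := gen_decide gF (@Rel L_Mac 1 MO (@Var L_Mac 1)) (fun=> repr x).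
  by left; apply/asboolP; apply: gen_sub gF _ _ _ Fx.
by right; apply: gen_sub gF _ _ _ Fx => e /negP.
Qed.

Lemma gringV x : x != 0 -> gring x || gring x^-1.
Proof.
move/coord_neq0 => x0; have [->//|Fx] := gring_decide x.
apply/orP; right; apply/asboolP; apply: gen_sub gF _ _ _
  (gen_setI gF (ginvP x) (gen_setI gF x0 Fx)) => e [/= E [xe0 nxe]].
by rewrite [coord _ _]E; have [xO|//] := valring_inv v xe0; rewrite xO in nxe.
Qed.

Variable c : nat.
Hypothesis c_max : valmax v c%:R.
Hypothesis c0 : c%:R != 0 :> K.

Lemma gen_const (A : Prop) : F [set e | A] -> A.
Proof.
move=> FA; apply: contrapT => nA; apply: (gen_set0 gF).
exact: gen_sub gF _ _ _ FA.
Qed.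

Lemma gnat_neq0 : c%:R != 0 :> gfield.
Proof.
apply/coord_neq0; apply: gen_sub gF _ _ _ (coord_nat c) => e /= E.
by rewrite E.
Qed.

Lemma gring_proper : exists x, ~~ gring x.
Proof.
exists c%:R^-1; apply/negP => /asboolP Fc.
suff : c%:R^-1 \in O by move: c_max; rewrite valmaxE // => /negP.
apply: gen_const; apply: gen_sub gF _ _ _
  (gen_setI gF Fc (gen_setI gF (ginvP c%:R) (coord_nat c))) => e [/= ? [E1 E2]].
by rewrite -E2 -E1.
Qed.

Definition gvaluation : valuation gfield :=
  ring_valuation gring1 gringB gringM gringV gring_proper.

Lemma gvalringE x : (x \in valring gvaluation) = gring x.
Proof. exact: valring_ring_valuation. Qed.

Local Notation N := (mac_structure gvaluation).

Lemma coord_eval k (t : term L_Mac k) (E : 'I_k -> N) :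
  F [set e | coord (eval E t) e = eval (fun i => coord (E i) e : M) t].
Proof.
elim: t => [i|[] a IH] /=.
- exact: gen_sub gF _ _ _ (gen_setT gF).
- apply: gen_sub gF _ _ _ (gen_setI gF (gaddP (eval E (a ord0)) (eval E (a ord_max)))
    (gen_setI gF (IH ord0) (IH ord_max))) => e [/= E0 [E1 E2]].
  by rewrite E0 E1 E2.
- apply: gen_sub gF _ _ _ (gen_setI gF (goppP (eval E (a ord0))) (IH ord0)) => e [/= E0 E1].
  by rewrite E0 E1.
- apply: gen_sub gF _ _ _ (gen_setI gF (gmulP (eval E (a ord0)) (eval E (a ord_max)))
    (gen_setI gF (IH ord0) (IH ord_max))) => e [/= E0 [E1 E2]].
  by rewrite E0 E1 E2.
- exact: gzeroP.
- exact: goneP.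
Qed.

Lemma coord_env_cons k x (E : 'I_k -> gfield) e :
  (fun i => coord (env_cons (x : N) E i) e : M) =
  env_cons (coord x e : M) (fun i => coord (E i) e).
Proof.
apply: funext => i; case: (unliftP ord0 i) => [j|] ->.
  by rewrite !env_consS.
by rewrite !env_cons0.
Qed.

(** This is the theorem of Łoś for the generic filter: definable sets are decided, and existential
    witnesses are coordinates. *)
Lemma coord_sat k (phi : formula L_Mac k) (E : 'I_k -> N) :
  sat phi E <-> F [set e | sat phi (fun i => coord (E i) e : M)].
Proof.
have decide k' (psi : formula L_Mac k') (E' : 'I_k' -> N) :
    F [set e | sat psi (fun i => coord (E' i) e : M)] \/
    F [set e | ~ sat psi (fun i => coord (E' i) e : M)].
  have [Fp|Fp] := gen_decide gF psi (fun i => repr (E' i : gfield)).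
    by left; apply: gen_sub gF _ _ _ Fp.
  by right; apply: gen_sub gF _ _ _ Fp.
have witness k' (psi : formula L_Mac k'.+1) (E' : 'I_k' -> N) :
    F [set e | sat (Ex psi) (fun i => coord (E' i) e : M)] ->
    exists x, F [set e | sat psi (fun i => coord (env_cons (x : N) E' i) e : M)].
  case/(gen_witness gF (r := fun i => repr (E' i : gfield))) => m Fm.
  exists (\pi_gfield m)%qT.
  apply: gen_sub gF _ _ _ (gen_setI gF Fm (coord_pi m)) => e [/= + Ee].
  by rewrite coord_env_cons Ee.
have sub A B := gen_sub gF (A := A) (B := B).
have contra A B : F A -> F B -> (forall e, A e -> B e -> False) -> False.
  move=> FA FB AB; apply: (gen_set0 gF); apply: sub (gen_setI gF FA FB) => e [].
  exact: AB.
elim: phi E => {k} k.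
- move=> s t E /=; have Es := coord_eval s E; have Et := coord_eval t E.
  rewrite -coord_eq; split=> Fst.
    by apply: sub (gen_setI gF Fst (gen_setI gF Es Et)) => e [/= + [<- <-]].
  by apply: sub (gen_setI gF Fst (gen_setI gF Es Et)) => e [/= + [-> ->]].
- move=> R a E; have Ea := coord_eval (a ord0) E.
  case: R a Ea => [|n n1] a Ea /=.
    rewrite -[valring gvaluation _]/(_ \in valring gvaluation) gvalringE.
    split=> [/asboolP|] Fa; [|apply/asboolP];
      by apply: sub (gen_setI gF Fa Ea) => e [/= + E1]; rewrite E1.
  split=> [[x0 [y xy]]|FP].
    move/coord_neq0: x0 => Fx0.
    apply: sub (gen_setI gF (gen_setI gF Fx0 Ea) (coordX y n)) => e [[/= + <-]].
    by rewrite xy => ? Ey; split=> //; exists (coord y e).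
  split.
    by apply/coord_neq0; apply: sub (gen_setI gF FP Ea) => e [/= [+ _] ->].
  (* [P_n] in the quotient asks for an actual root there, so [x = y^n] is written as a formula and
     its witness is taken from the filter. *)
  have [|y Fy] := witness 1%N (Eq (Var L_Mac (lift ord0 ord0)) (pow_term (Var L_Mac ord0) n))
      (fun=> eval E (a ord0)).
    apply: sub (gen_setI gF FP Ea) => e [/= [_ [y ye]] E1]; exists y.
    by rewrite eval_pow_term /= env_cons0 env_consS E1.
  exists y; apply/coord_eq.
  apply: sub (gen_setI gF Fy (coordX y n)) => e [/= + ->].
  by rewrite coord_env_cons /= eval_pow_term /= env_cons0 env_consS.
- move=> a IH E /=; rewrite IH; split=> [nFa|Fna Fa].
    by have [] := decide _ a E.
  exact: contra Fa Fna _.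
- move=> a IHa b IHb E /=; rewrite IHa IHb; split=> [[Fa Fb]|Fab].
    exact: sub (gen_setI gF Fa Fb).
  by split; apply: sub Fab => e [].
- move=> a IHa b IHb E /=; rewrite IHa IHb; split=> [[Fa|Fb]|Fab].
  + by apply: sub Fa => e; left.
  + by apply: sub Fb => e; right.
  have [|Fna] := decide _ a E; first by left.
  by right; apply: sub (gen_setI gF Fab Fna) => e [/= []].
- move=> a IH E /=; split=> [[x /IH Fx]|/witness[x Fx]]; last by exists x; apply/IH.
  by apply: sub Fx => e /=; rewrite coord_env_cons; exists (coord x e).
move=> a IH E /=; split=> [ax|Fa x]; last first.
  by apply/IH; apply: sub Fa => e /= /(_ (coord x e)); rewrite coord_env_cons.
(* If the universal formula failed on a set of the filter, a counterexample would be a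
   coordinate. *)
have [//|Fna] := decide _ (All a) E.
have [|x Fx] := witness _ (Not a) E.
  by apply: sub Fna => e /= nall; apply: contrapT => nex; apply: nall => y;
    apply: contrapT => ny; apply: nex; exists y.
by case: (contra _ _ Fx ((IH _).1 (ax x))).
Qed.

Lemma gvaluation_equiv : elem_equiv N M.
Proof.
move=> s; rewrite /Th /= coord_sat.
have nilE e : (fun i => coord (@env_nil _ N i) e : M) = @env_nil _ M.
  by apply: funext => -[].
split=> [Fs|Ms].
  by apply: gen_const; apply: gen_sub gF _ _ _ Fs => e /=; rewrite nilE.
by apply: gen_sub gF _ _ _ (gen_setT gF) => e _ /=; rewrite nilE.
Qed.

(** Every element of the quotient is named by a coordinate, so bounds on the coordinates give the
    two conditions of [rank1_criterion]. *)
Lemma gvaluation_rank1 :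
  (forall n, exists k, F [set e | e n = 0 \/ c%:R ^+ k / (e n : K) \in O]) ->
  (forall n, exists k, F [set e | e n != 0 -> valmax v (e n) ->
     (e n : K) ^+ k / c%:R \in O]) ->
  rank1 gvaluation.
Proof.
move=> cof arch.
have divE x y (Fxy : F [set e | coord x e / coord y e \in O]) :
    x / y \in valring gvaluation by rewrite gvalringE coord_div_gring.
have maxE x : x != 0 -> valmax gvaluation x -> F [set e | valmax v (coord x e)].
  move=> x0; rewrite valmaxE // gvalringE => nx.
  have Fx0 := (coord_neq0 x).1 x0.
  have [gx|Fx] := gring_decide x^-1; first by rewrite gx in nx.
  apply: gen_sub gF _ _ _ (gen_setI gF Fx0 (gen_setI gF Fx (ginvP x))) => e.
  by move=> [/= xe0 [+ E]]; rewrite valmaxE // [coord _ _]E.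
apply: (@rank1_criterion _ _ c%:R).
- rewrite valmaxE ?gnat_neq0 // gvalringE; apply/negP => /asboolP Fc.
  suff : c%:R^-1 \in O by move: c_max; rewrite valmaxE // => /negP.
  apply: gen_const; apply: gen_sub gF _ _ _
    (gen_setI gF Fc (gen_setI gF (ginvP c%:R) (coord_nat c))) => e [/= ? [E1 E2]].
  by rewrite -E2 -E1.
- exact: gnat_neq0.
- move=> x /coord_neq0 Fx0; have [k Fk] := cof (repr x); exists k; apply: divE.
  apply: gen_sub gF _ _ _ (gen_setI gF (gen_setI gF Fx0 Fk)
    (gen_setI gF (coordX c%:R k) (coord_nat c))) => e [[/= xe0 +] [-> ->]].
  by rewrite -/(coord x e) => -[E|//]; rewrite E eqxx in xe0.
move=> x x0 xm; have [k Fk] := arch (repr x); exists k; apply: divE.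
apply: gen_sub gF _ _ _ (gen_setI gF
  (gen_setI gF ((coord_neq0 x).1 x0) (gen_setI gF (maxE x x0 xm) Fk))
    (gen_setI gF (coordX x k) (coord_nat c))) => e [[/= xe0 [xme H]] [-> ->]].
exact: H.
Qed.

End GenericField.

(** * A generic filter that omits both types *)

Section Omission.
Variables (K : fieldType) (v : valuation K).
Local Notation O := (valring v).
Local Notation M := (mac_structure v).
Implicit Types x y z : K.

Fixpoint nat_term k n : term L_Mac k.+1 :=
  if n is m.+1 then
    @App L_Mac k.+1 MAdd (fun i => if i == ord0 then nat_term k m
                                   else @App L_Mac k.+1 MOne (fun=> Var L_Mac ord0))
  else @App L_Mac k.+1 MZero (fun=> Var L_Mac ord0).

Lemma eval_nat_term k n (e : 'I_k.+1 -> M) : eval e (nat_term k n) = n%:R :> K.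
Proof. by elim: n => [|n IH] //=; rewrite IH -addn1 natrD. Qed.

(** Divisibility of one term by another covers every set chosen below: [y] divides [p^k], [p]
    divides [y^k], [y] divides 1, and 0 divides [y]. *)
Lemma divides_formula (s t : term L_Mac 1) : exists psi : formula L_Mac 1,
  forall y, sat psi (fun=> y : M) <->
    exists2 z, z \in O & z * eval (fun=> y : M) s = eval (fun=> y : M) t.
Proof.
exists (Ex (And (@Rel L_Mac 2 MO (fun=> Var L_Mac ord0))
  (Eq (@App L_Mac 2 MMul (fun i => if i == ord0 then Var L_Mac ord0
                                   else term_rename (lift ord0) s))
      (term_rename (lift ord0) t)))) => y /=.
have E (z : M) : env_cons z (fun=> y) \o lift ord0 = fun=> y :> M.
  by apply: funext => i; rewrite /= env_consS.
split=> [[z]|[z zO zst]]; last exists z; rewrite !eval_rename !E !env_cons0.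
  by case=> zO zst; exists z.
by split.
Qed.

Variable p : nat.
Hypotheses (char_K : [pchar K] =i pred0) (p_pr : prime p)
  (p_max : valmax v p%:R) (prohens : prohenselian_degree1 v)
  (qe : admits_QE (Th M)) (tight_v : tight v p).

Lemma rank1_generic_filter : exists F : set (nat -> M) -> Prop,
  [/\ generic_filter F,
      (forall n, exists k, F [set e | e n = 0 \/ p%:R ^+ k / (e n : K) \in O]) &
      (forall n, exists k, F [set e | e n != 0 -> valmax v (e n) ->
         (e n : K) ^+ k / p%:R \in O])].
Proof.
have p0 := natr_neq0 char_K (prime_gt0 p_pr).
(* Index 0 carries the type of infinitesimals and every other index the second type. The bound [k]
   is uniform on [B], hence one formula of the type fails on all of [B]. *)
pose P n (B : set M) := if n is 0 then
    exists k, forall y : K, B y -> y = 0 \/ p%:R ^+ k / y \in O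
  else exists k, forall y : K, B y -> y != 0 -> valmax v y -> y ^+ k / p%:R \in O.
pose X : term L_Mac 1 := Var L_Mac ord0.
have defB (s t : term L_Mac 1) : exists psi : formula L_Mac 1, forall y,
    [set y | exists2 z, z \in O & z * eval (fun=> y : M) s = eval (fun=> y : M) t] y <->
    sat psi (fun=> y : M).
  by have [psi psiP] := divides_formula s t; exists psi => y; rewrite psiP.
(* This set is [{0}], written as the multiples of 0 so that [divides_formula] applies. *)
have B0 n : P n [set y : M | exists2 z, z \in O & z * 0 = y :> K].
  case: n => [|n]; exists 0%N => y [z _]; rewrite mulr0 => <-; first by left.
  by rewrite eqxx.
have def0 : exists psi : formula L_Mac 1, forall y,
    [set y : M | exists2 z, z \in O & z * 0 = y :> K] y <-> sat psi (fun=> y : M).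
  have [psi psiP] := defB (nat_term 0 0) X; exists psi => y; rewrite -psiP /=.
  by [].
pose cf (f : func L_Mac) := match f with
  MAdd => 0 | MOpp => 1 | MMul => 2 | MZero => 3 | MOne => 4 end%N.
(* The code 0 of [MO] is free because [P_n] has [n > 1]. *)
pose cr (r : rsym L_Mac) := if r is MP n _ then n else 0%N.
have cf_inj : injective cf by case; case.
have cr_inj : injective cr.
  move=> [|n n1] [|m m1] //= E; first by subst m.
    by subst n.
  by subst m; rewrite (bool_irrelevance n1 m1).
have [|F [gF FP]] := @generic_filter_omitting _ M _ _ cf_inj cr_inj (0 : K) P.
  move=> n A [x Ax] [psi psiP]; case: n => [|n].
    have [|y /psiP Ay fin] :=
      infinitesimal_nonisolated char_K p_pr p_max prohens qe (psi := psi) (x := x).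
      exact/psiP.
    have [y0|[k pky]] : y = 0 \/ exists k, p%:R ^+ k / y \in O by [].
      eexists; split; [exact: (B0 0%N)| |exact: def0].
      by exists y; split=> //; exists 0; rewrite ?rpred0 // y0 mulr0.
    have [y0|y0] := eqVneq y 0.
      eexists; split; [exact: (B0 0%N)| |exact: def0].
      by exists y; split=> //; exists 0; rewrite ?rpred0 // y0 mulr0.
    eexists; split; last exact: (defB X (pow_term (nat_term 0 p) k)).
      exists k => u [z zO]; rewrite eval_pow_term eval_nat_term /= => zu; right.
      have u0 : u != 0.
        apply/eqP => u0; move: zu; rewrite u0 mulr0 => /esym/eqP.
        by rewrite (negPf (expf_neq0 _ p0)).
      by rewrite -zu mulfK.
    exists y; split=> //; exists (p%:R ^+ k / y) => //.
    by rewrite eval_pow_term eval_nat_term /= divfK.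
  have [x0|x0] := eqVneq (x : K) 0.
    eexists; split; [exact: (B0 n.+1)| |exact: def0].
    by exists x; split=> //; exists 0; rewrite ?rpred0 // x0 mulr0.
  have [xm|xm] := boolP (valmax v x).
    have [k xk] := tight_archimedean tight_v xm x0.
    eexists; split; last exact: (defB (nat_term 0 p) (pow_term X k)).
      by exists k => u [z zO]; rewrite eval_pow_term eval_nat_term /= => <- _ _; rewrite mulfK.
    exists x; split=> //; exists ((x : K) ^+ k / p%:R) => //.
    by rewrite eval_pow_term eval_nat_term /= divfK.
  (* Here [x^-1] is in [O]. A nonzero element with this property is not in the maximal ideal, so the
     requirement holds vacuously on [B]. *)
  eexists; split; last exact: (defB X (nat_term 0 1)).
    exists 0%N => u [z zO]; rewrite eval_nat_term /= => zu u0.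
    by rewrite valmaxE // (_ : u^-1 = z) ?zO //; apply: (mulIf u0); rewrite mulVf // zu.
  exists x; split=> //; exists (x : K)^-1; last by rewrite eval_nat_term /= mulVf.
  by move: xm; rewrite valmaxE // negbK.
exists F; split=> // n.
  have [B [k Bk] FB] := FP 0%N n; exists k.
  by apply: gen_sub gF _ _ _ FB => e; apply: Bk.
have [B [k Bk] FB] := FP 1%N n; exists k.
by apply: gen_sub gF _ _ _ FB => e; apply: Bk.
Qed.

End Omission.

Theorem theorem3p19 (K : fieldType) (v : valuation K) (p : nat)
    (char_K : [pchar K]%R =i pred0)
    (char_residue : p \in [pchar (residue_ring v)]%R)
    (qe : admits_QE (Th (mac_structure v)))
    (prohens : prohenselian_degree1 v)
    (tight_v : tight v p)
    (cons : exists C : mul_subgroup K, conservative v p C) :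
  exists (L : fieldType) (w : valuation L),
    rank1 w /\ elem_equiv (mac_structure w) (mac_structure v).
Proof.
move: char_residue; rewrite pchar_residue_ring => /andP[p_pr p_max].
have p0 := natr_neq0 char_K (prime_gt0 p_pr).
have [F [gF cof arch]] := rank1_generic_filter char_K p_pr p_max prohens qe tight_v.
exists (gfield gF), (gvaluation gF p_max p0).
by split; [apply: gvaluation_rank1|apply: gvaluation_equiv].
Qed.
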